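(* The universal asymptotic variance $\Sigma^2$ and the minimal discrepancy density for hyperbolic zero packing $\rho_{\mathbb{H}}$ satisfy $$\Sigma^2=1-\rho_{\mathbb{H}} .$$
   Context: $\mathbb{D}$ is the open unit disk, $\mathbb{T}=\partial\mathbb{D}$, $\mathbb{D}(0,r)=\{z\in\mathbb{C}:|z|<r\}$; $\mathrm{d}A(z)=\frac{1}{\pi}\mathrm{d}x\,\mathrm{d}y$ is normalized area measure and $\mathrm{d}s(z)=\frac{|\mathrm{d}z|}{2\pi}$ is normalized arc length measure. The Bergman projection of $\mu\in L^1(\mathbb{D})$ is $$\mathbf{P}\mu(z):=\int_{\mathbb{D}}\frac{\mu(w)}{(1-z\bar w)^2}\,\mathrm{d}A(w),\qquad z\in\mathbb{D}.$$ For a holomorphic $g:\mathbb{D}\to\mathbb{C}$ with dilates $g_r(\zeta):=g(r\zeta)$, the asymptotic variance is $$\sigma^2(g):=\limsup_{r\to1^-}\frac{\int_{\mathbb{T}}|g_r|^2\,\mathrm{d}s}{\log\frac{1}{1-r^2}},$$ and the universal asymptotic variance is $$\Sigma^2:=\sup\big\{\sigma^2(g):\ g=\mathbf{P}\mu,\ \mu\in L^\infty(\mathbb{D}),\ \|\mu\|_{L^\infty(\mathbb{D})}=1\big\}.$$ The minimal discrepancy density for hyperbolic zero packing is $$\rho_{\mathbb{H}}:=\liminf_{r\to1^-}\ \inf_f\ \frac{1}{\log\frac{1}{1-r^2}}\int_{\mathbb{D}(0,r)}\big((1-|z|^2)|f(z)|-1\big)^2\,\frac{\mathrm{d}A(z)}{1-|z|^2},$$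 where the infimum runs over all polynomials $f$ with complex coefficients. *)

(* Defs.v *)
From mathcomp Require Import all_boot all_order all_algebra.
From mathcomp Require Import all_classical all_reals all_analysis.
From mathcomp Require Import measurable_realfun complex.

Set Implicit Arguments.
Unset Strict Implicit.
Unset Printing Implicit Defensive.

Import Order.TTheory GRing.Theory Num.Theory.
Import numFieldNormedType.Exports.

Local Open Scope classical_set_scope.
Local Open Scope ring_scope.
Local Open Scope complex_scope.

(* The complex plane occurs in two forms: R[i] for the field structure, and
   [plane R], i.e. R * R with its Borel sets, for the Lebesgue measure; [cplx]
   identifies the second with the first.
   [modulus] is R-valued, whereas the norm [`|z|] of z : R[i] lies in R[i]. *)

Notation plane R := (measurableTypeR R * measurableTypeR R)%type.

Section Plane.
Variable R : realType.

Definition cplx (w : plane R) : R[i] := w.1 +i* w.2.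

Definition modulus (z : R[i]) : R := ComplexField.Normc.normc z.

Definition disk (r : R) : set (plane R) := [set w | modulus (cplx w) < r].

Lemma measurable_disk (r : R) : measurable (disk r).
Proof.
have mf : measurable_fun [set: plane R]
    (fun w : plane R => Num.sqrt ((w.1 : R) ^+ 2 + (w.2 : R) ^+ 2)).
  apply: (measurableT_comp (f := @Num.sqrt R)).
    exact: continuous_measurable_fun (@sqrt_continuous R).
  by apply: measurable_funD; apply: measurable_funX.
have := mf measurableT _ (measurable_itv `]-oo, r[).
congr measurable; apply/seteqP; split => w /=; rewrite in_itv/=.
- by case.
- by split.
Qed.

Lemma invr_pi_ge0 : 0 <= pi^-1 :> R.
Proof. by rewrite invr_ge0 pi_ge0. Qed.

Definition dA : {measure set (plane R) -> \bar R} :=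
  mscale (NngNum invr_pi_ge0) (@lebesgue_measure R \x @lebesgue_measure R)%E.

Definition dA_disk : {measure set (plane R) -> \bar R} :=
  mrestr dA (measurable_disk 1).

End Plane.

Section AsymptoticVariance.
Variable R : realType.

(* Bounded measurable functions on the unit disk are represented by functions
   on the whole plane, of which only the values on the disk are used. *)
Definition measurable_on_disk (mu : plane R -> R[i]) : Prop :=
  measurable_fun (disk 1) (fun w => complex.Re (mu w)) /\
  measurable_fun (disk 1) (fun w => complex.Im (mu w)).

Definition Linfty_norm (mu : plane R -> R[i]) : \bar R :=
  'N[dA_disk R]_+oo[(fun w => (modulus (mu w))%:E)]%E.

Definition complex_integral (D : set (plane R)) (h : plane R -> R[i]) : R[i] :=
  (\int[dA R]_(w in D) complex.Re (h w)) +i*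
  (\int[dA R]_(w in D) complex.Im (h w)).

(* Meaningful for |z| < 1. *)
Definition bergman_projection (mu : plane R -> R[i]) (z : R[i]) : R[i] :=
  complex_integral (disk 1)
    (fun w => mu w / (1 - z * conjc (cplx w)) ^+ 2).

Definition dilate (g : R[i] -> R[i]) (r : R) (zeta : R[i]) : R[i] :=
  g (r%:C * zeta).

(* Integral over the unit circle against normalized arc length. *)
Definition circle_integral (u : R[i] -> \bar R) : \bar R :=
  (((2 * pi)^-1)%:E *
   \int[@lebesgue_measure R]_(t in `[0%R, (2 * pi)%R]) u (cos t +i* sin t))%E.

Definition log_weight (r : R) : R := ln (1 / (1 - r ^+ 2)).

Definition asymptotic_variance (g : R[i] -> R[i]) : \bar R :=
  limf_esup
    (fun r : R =>
       circle_integral (fun zeta => (modulus (dilate g r zeta) ^+ 2)%:E)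
       / (log_weight r)%:E)%E
    (1%R : R)^'-.

Definition universal_asymptotic_variance : \bar R :=
  ereal_sup [set asymptotic_variance (bergman_projection mu) |
    mu in [set mu | measurable_on_disk mu /\ Linfty_norm mu = 1%E]].

End AsymptoticVariance.

Section ZeroPacking.
Variable R : realType.

Definition discrepancy (r : R) (f : {poly R[i]}) : \bar R :=
  (((log_weight r)^-1)%:E *
   \int[dA R]_(w in disk r)
     ((((1 - modulus (cplx w) ^+ 2) * modulus f.[cplx w] - 1) ^+ 2
       / (1 - modulus (cplx w) ^+ 2))%R)%:E)%E.

Definition zero_packing_density : \bar R :=
  limf_einf
    (fun r : R => ereal_inf [set discrepancy r f | f in [set: {poly R[i]}]])
    (1%R : R)^'-.

End ZeroPacking.

(* Main.v *)
Require Import Defs.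
From mathcomp Require Import all_boot all_order all_algebra.
From mathcomp Require Import all_classical all_reals all_analysis.
From mathcomp Require Import measurable_realfun complex ess_sup_inf.
From mathcomp Require Import ring lra.

Set Implicit Arguments.
Unset Strict Implicit.
Unset Printing Implicit Defensive.

Import Order.TTheory GRing.Theory Num.Theory.
Import numFieldNormedType.Exports.

Local Open Scope classical_set_scope.
Local Open Scope ring_scope.
Local Open Scope complex_scope.

(** Write L(r) = log (1 / (1 - r^2)), which is the integral of 1 / (1 - |z|^2)
    over D(0,r) against dA. Expanding the square, L(r) times the discrepancy of
    f at r equals L - 2 J + I, where J is the integral of |f| over D(0,r) and I
    that of (1 - |z|^2) |f|^2. Hence 1 - rho is the upper limit of
    sup_f (2 J - I) / L.

    For g = P mu the mean of |g|^2 over the circle of radius r is the supremum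
    over N of the energies X_N = sum_(n < N) (n+1)^2 |c_n|^2 r^(2n), where c_n
    is the integral of mu(w) conj(w)^n over the unit disk
    ([circle_mean_energy]). Both inequalities come from pairing mu with
    polynomials and from the identity
    int_D (1 - |w|^2) |sum a_n w^n|^2 dA = sum |a_n|^2 / ((n+1)(n+2))
    ([parseval_disk]).

    Upper inequality. Let a_n = (n+1)^2 r^n c_n for n < N and f = sum a_n z^n.
    The pairing of mu with f(r w) is X_N, so X_N <= int_D |f(r w)| = r^-2 J when
    |mu| <= 1, while I <= sum |a_n|^2 / ((n+1)(n+2)) <= X_N. Thus
    2 J - I >= (2 r^2 - 1) X_N ([energy_discrepancy]), and r tends to 1.

    Lower inequality. Let f have 2 J - I > c L at r; this forces I <= 4 L. Take
    mu unimodular and equal to p / |p| with p(w) = w f(r^2 w). Then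
    X_N >= 2 Re int mu conj(p) - sum |p_n|^2 / ((n+1)^2 r^(2n)), and the last sum
    is at most r^-4 I. Passing from f on D(0,r) to p on the unit disk changes
    the integral of the modulus only by a small multiple of I plus a constant,
    since the annulus r^2 <= |z| < r has bounded mass for dA / (1 - |z|^2)
    ([shifted_mass_ge]). Prescribing mu only on an annulus s <= |w| < t costs,
    again by the inequality 2x <= d (1 - |w|^2) x^2 + 1 / (d (1 - |w|^2)), a small
    multiple of I, a constant depending on s, and a quantity which vanishes as t
    tends to 1 ([energy_lower]). As L tends to infinity, one obtains circles of
    radius close to 1 together with such annuli ([extremal_annulus]), and a
    single mu which is extremal for infinitely many of them
    ([glued_competitor]); the latter suffices since sigma^2 is an upper limit.

    The identities for area integrals rest on the invariance of the plane
    measure under rotations, which are products of shears, on its behaviour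
    under dilations, and on the fact that |w|^2 has the Lebesgue measure of the
    half-line as its distribution under dA ([ge0_integral_radial]). *)


(** * Area measure under linear maps of the plane *)

Section PlaneMeasure.
Variable R : realType.
Local Notation leb := (@lebesgue_measure R).
Local Notation leb2 := (@lebesgue_measure R \x @lebesgue_measure R)%E.

Lemma measurable_addr (c : R) : measurable_fun [set: measurableTypeR R]
  (fun y : measurableTypeR R => y + c : measurableTypeR R).
Proof. exact: measurable_funD. Qed.

Lemma measurable_scaler (t : R) : measurable_fun [set: measurableTypeR R]
  (fun y : measurableTypeR R => t * y : measurableTypeR R).
Proof. exact: measurable_funM. Qed.

Lemma lebesgue_measure_translation (c : R) (A : set (measurableTypeR R)) :
  measurable A -> leb ((fun y => y + c) @^-1` A) = leb A.
Proof.
move=> mA; have mf := measurable_addr c.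
apply/esym; apply: (lebesgue_measure_unique (mu := pushforward leb
  (fun y : measurableTypeR R => y + c : measurableTypeR R))) => //.
move=> _ [[a b]] _ <-; rewrite /= /pushforward.
rewrite (_ : _ @^-1` _ = `](a - c), (b - c)]%classic).
  rewrite !lebesgue_measure_itv/= !lte_fin ltrD2r; case: ifPn => // _.
  by rewrite -!EFinB; congr EFin; ring.
by apply/seteqP; split => y /=; rewrite !in_itv/= ltrBlDr lerBrDr.
Qed.

Lemma lebesgue_measure_scaling (t : R) (A : set (measurableTypeR R)) :
  0 < t -> measurable A -> (t%:E * leb ((fun y => t * y)%R @^-1` A))%E = leb A.
Proof.
move=> t0 mA; have mf := measurable_scaler t.
apply/esym; apply: (lebesgue_measure_unique (mu := mscale (NngNum (ltW t0))
  (pushforward leb (fun y : measurableTypeR R => t * y : measurableTypeR R)))) => //.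
move=> _ [[a b]] _ <-; rewrite /= /mscale /= /pushforward.
rewrite (_ : _ @^-1` _ = `](t^-1 * a), (t^-1 * b)]%classic).
  rewrite !lebesgue_measure_itv/= !lte_fin ltr_pM2l ?invr_gt0//.
  case: ifPn => // _; last by rewrite mule0.
  by rewrite -!EFinB -EFinM; congr EFin; field; rewrite gt_eqF.
apply/seteqP; split => y /=; rewrite !in_itv/=.
  by rewrite ltr_pdivrMl// ler_pdivlMl.
by rewrite ltr_pdivrMl// ler_pdivlMl.
Qed.

(** Maps of the plane for which the preimage of a set of area [a] has area
    [k * a]. *)
Definition scales_area (k : R) (T : plane R -> plane R) : Prop :=
  measurable_fun [set: plane R] T /\
  forall A : set (plane R), measurable A -> (leb2 (T @^-1` A) = k%:E * leb2 A)%E.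

Lemma measurable_preimage_plane (T : plane R -> plane R) (A : set (plane R)) :
  measurable_fun [set: plane R] T -> measurable A -> measurable (T @^-1` A).
Proof. by move=> mT mA; rewrite -[X in measurable X]setTI; exact: mT. Qed.

Lemma scales_area_comp (k l : R) (S T : plane R -> plane R) :
  scales_area k S -> scales_area l T -> scales_area (k * l) (T \o S).
Proof.
move=> [mS eS] [mT eT]; split; first exact: measurableT_comp.
move=> A mA; rewrite comp_preimage eS; last exact: measurable_preimage_plane.
by rewrite eT// muleA EFinM.
Qed.

(** The linear maps of the plane in use: exchange of the coordinates, shear,
    homothety, and multiplication by the complex number [c +i* s]. *)
Definition swap_plane (w : plane R) : plane R := (w.2, w.1).

Definition shear_plane (a : R) (w : plane R) : plane R := (w.1, w.2 + a * w.1).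

Definition dilate_plane (t : R) (w : plane R) : plane R := (t * w.1, t * w.2).

Definition rotate_plane (c s : R) (w : plane R) : plane R :=
  (c * w.1 - s * w.2, s * w.1 + c * w.2).

Lemma scales_area_swap : scales_area 1 swap_plane.
Proof.
have mS : measurable_fun [set: plane R] swap_plane by exact: measurable_fun_pair.
split=> // A mA; rewrite mul1e; apply/esym.
apply: (product_measure_unique (m1 := leb) (m2 := leb)
  (m' := pushforward leb2 swap_plane)) => // B C mB mC.
rewrite -[LHS]/(leb2 (swap_plane @^-1` (B `*` C))) (_ : _ @^-1` _ = C `*` B).
  by rewrite product_measure1E// muleC.
by apply/seteqP; split => -[x y] [].
Qed.

(** By Fubini: a shear translates each vertical section. *)
Lemma scales_area_shear (a : R) : scales_area 1 (shear_plane a).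
Proof.
split.
  apply: measurable_fun_pair => //; apply: measurable_funD => //.
  exact: measurable_funM.
move=> A mA; rewrite mul1e /product_measure1; apply: eq_integral => x _ /=.
rewrite -[RHS](lebesgue_measure_translation (a * x)); last exact: measurable_xsection.
congr (leb _); apply/seteqP; split => y /=;
  by rewrite /xsection/= !inE.
Qed.

Lemma scales_area_dilation (t : R) : 0 < t ->
  scales_area (t ^- 2) (dilate_plane t).
Proof.
move=> t0; have mS : measurable_fun [set: plane R] (dilate_plane t).
  by apply: measurable_fun_pair; exact: measurable_funM.
split=> // A mA.
have t2 : 0 <= t ^+ 2 by rewrite exprn_ge0// ltW.
have -> : leb2 A = ((t ^+ 2)%:E * leb2 (dilate_plane t @^-1` A))%E.
  apply: (product_measure_unique (m1 := leb) (m2 := leb)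
    (m' := mscale (NngNum t2) (pushforward leb2 (dilate_plane t)))) => //.
  move=> B C mB mC.
  rewrite -[LHS]/((t ^+ 2)%:E * leb2 (dilate_plane t @^-1` (B `*` C)))%E.
  rewrite (_ : _ @^-1` _ =
      ((fun y => t * y) @^-1` B) `*` ((fun y => t * y) @^-1` C)).
    rewrite product_measure1E; last 2 first.
    - by rewrite -[X in measurable X]setTI; exact: measurable_scaler.
    - by rewrite -[X in measurable X]setTI; exact: measurable_scaler.
    apply: etrans (congr2 mule (lebesgue_measure_scaling t0 mB)
      (lebesgue_measure_scaling t0 mC)).
    by rewrite expr2 EFinM; exact: muleACA.
  by apply/seteqP; split => -[x y] [].
by rewrite muleA -EFinM mulVf ?mul1e// expf_neq0// gt_eqF.
Qed.

(** A rotation other than the half turn is a product of three shears. *)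
Lemma scales_area_rotation (c s : R) : c ^+ 2 + s ^+ 2 = 1 -> 1 + c != 0 ->
  scales_area 1 (rotate_plane c s).
Proof.
move=> cs c1; pose a := - (s / (1 + c)).
pose H := swap_plane \o shear_plane a \o swap_plane.
have comp1 S T : scales_area 1 S -> scales_area 1 T -> scales_area 1 (T \o S).
  by move=> hS hT; rewrite -[1]mulr1; exact: scales_area_comp.
have sH : scales_area 1 H.
  exact: comp1 scales_area_swap (comp1 _ _ (scales_area_shear _) scales_area_swap).
rewrite (_ : rotate_plane c s = H \o (shear_plane s \o H)).
  exact: comp1 (comp1 _ _ sH (scales_area_shear _)) sH.
have ha : a * (1 + c) = - s by rewrite /a mulNr divfK.
have hs : s * a = c - 1.
  apply: (mulIf c1); rewrite -mulrA ha; have : s ^+ 2 = 1 - c ^+ 2 by lra.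
  by rewrite expr2 => e; rewrite mulrN e; ring.
apply/funext => -[x y]; rewrite /H/= /rotate_plane /swap_plane /shear_plane /=; congr pair.
  have -> : x + a * y + a * (y + s * (x + a * y)) =
    x + (s * a) * x + (a * (1 + c) + a * (1 - c + s * a)) * y by ring.
  by rewrite ha hs; ring.
have -> : y + s * (x + a * y) = s * x + (1 + s * a) * y by ring.
by rewrite hs; ring.
Qed.

End PlaneMeasure.

(** * Radial area integrals *)

Section Radial.
Variable R : realType.
Local Notation leb := (@lebesgue_measure R).
Local Notation leb2 := (@lebesgue_measure R \x @lebesgue_measure R)%E.

(** The squared modulus, as a function on the plane. *)
Definition sqmod (w : plane R) : R := w.1 ^+ 2 + w.2 ^+ 2.

Lemma sqmod_ge0 w : 0 <= sqmod w.
Proof. by rewrite addr_ge0// sqr_ge0. Qed.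

Lemma sqmod_modulus w : modulus (cplx w) ^+ 2 = sqmod w.
Proof. by rewrite sqr_sqrtr// sqmod_ge0. Qed.

Lemma measurable_sqmod : measurable_fun [set: plane R] (sqmod : plane R -> measurableTypeR R).
Proof. by apply: measurable_funD; exact: measurable_funX. Qed.

Lemma diskE (r : R) : 0 <= r -> disk r = sqmod @^-1` `[0, (r ^+ 2)[%classic.
Proof.
move=> r0; apply/seteqP; split => w /=; rewrite in_itv/= sqmod_ge0 /disk/= -sqmod_modulus
  ltr_pXn2r// ?nnegrE//; exact: sqrtr_ge0.
Qed.

(** The closed disk with squared radius [b]. *)
Definition cdisk (b : R) : set (plane R) := [set w | sqmod w <= b].

Lemma measurable_cdisk b : measurable (cdisk b).
Proof.
have := measurable_sqmod measurableT (measurable_itv `]-oo, b]).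
rewrite setTI; congr measurable; apply/seteqP; split => w /=; by rewrite in_itv.
Qed.

(** The area of the unit disk, known only at the end to be [pi]. *)
Let kappa := leb2 (cdisk 1).

Lemma sqmod_dilate t w : sqmod (dilate_plane t w) = t ^+ 2 * sqmod w.
Proof. by rewrite /sqmod /dilate_plane/=; ring. Qed.

Let cdisk_area_pos b : 0 < b -> leb2 (cdisk b) = (b%:E * kappa)%E.
Proof.
move=> b0; have t0 : 0 < (Num.sqrt b)^-1 by rewrite invr_gt0 sqrtr_gt0.
have [_ /(_ _ (measurable_cdisk 1))] := scales_area_dilation t0.
rewrite exprVn sqr_sqrtr ?(ltW b0)// invrK => <-; congr (leb2 _).
apply/seteqP; split => w; rewrite /cdisk/= sqmod_dilate exprVn sqr_sqrtr ?(ltW b0)//.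
  by rewrite ler_pdivrMl// mulr1.
by rewrite ler_pdivrMl// mulr1.
Qed.

Let cdisk_area0 : leb2 (cdisk 0) = 0%E.
Proof.
rewrite (_ : cdisk 0 = [set 0] `*` [set 0]).
  rewrite product_measure1E; last 2 first.
    exact: measurable_set1.
    exact: measurable_set1.
  by rewrite [X in (X * _)%E](_ : _ = 0%E) ?mul0e//; exact: lebesgue_measure_set1.
apply/seteqP; split => -[x y]; rewrite /cdisk /sqmod/=.
  move=> h; have : x ^+ 2 == 0 by rewrite eq_le sqr_ge0 andbT (le_trans _ h)// lerDl sqr_ge0.
  have : y ^+ 2 == 0 by rewrite eq_le sqr_ge0 andbT (le_trans _ h)// lerDr sqr_ge0.
  by rewrite !sqrf_eq0 => /eqP -> /eqP ->.
by case=> -> ->; rewrite expr0n/= addr0.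
Qed.

Let cdisk_neg b : b < 0 -> cdisk b = set0.
Proof.
move=> b0; apply/seteqP; split => w //; rewrite /cdisk/= => h.
by have := lt_le_trans b0 (le_trans (sqmod_ge0 w) h); rewrite ltxx.
Qed.

Let kappa_fin : kappa \is a fin_num.
Proof.
rewrite ge0_fin_numE ?measure_ge0//; apply: (@le_lt_trans _ _ (leb2 (`[-1, 1] `*` `[-1, 1]))).
  apply: le_measure; rewrite ?inE.
  - exact: measurable_cdisk.
  - by apply: measurableX; exact: measurable_itv.
  have H (x y : R) : x ^+ 2 + y ^+ 2 <= 1 -> x \in `[-1, 1].
    move=> h; rewrite in_itv/= -ler_norml -(expr_le1 (n := 2))// real_normK ?num_real//.
    by rewrite (le_trans _ h)// lerDl sqr_ge0.
  move=> -[x y]; rewrite /cdisk /sqmod /= => h; split => /=; first exact: H h.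
  by apply: (H _ x); rewrite addrC.
rewrite product_measure1E; last 2 first.
  exact: measurable_itv.
  exact: measurable_itv.
have e : leb `[-1, 1] = (2 : R)%:E.
  by rewrite lebesgue_measure_itv/= lte_fin ifT; [rewrite -EFinB; congr EFin; ring|lra].
apply: (@le_lt_trans _ _ ((2 : R)%:E * (2 : R)%:E)%E); last by rewrite -EFinM ltry.
by rewrite le_eqVlt; apply/orP; left; apply/eqP; exact: (congr2 mule e e).
Qed.

Let kappaE : ((fine kappa)%:E = kappa)%E. Proof. by rewrite fineK. Qed.

Let kappa_ge0 : 0 <= fine kappa. Proof. by rewrite fine_ge0// measure_ge0. Qed.

Let cdisk_area b : leb2 (cdisk b) = (Num.max b 0 * fine kappa)%:E.
Proof.
have [b0|b0|->] := ltgtP b 0.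
- by rewrite cdisk_neg// measure0 mul0r.
- by rewrite cdisk_area_pos// EFinM kappaE.
- by rewrite cdisk_area0 mul0r.
Qed.

Let lebesgue_measure_pos_itv a b : a <= b ->
  leb (`]a, b]%classic `&` `[0, +oo[%classic) = (Num.max b 0 - Num.max a 0)%:E.
Proof.
move=> ab; have [a0|a0] := leP 0 a.
  rewrite (max_idPl (le_trans a0 ab)) (_ : _ `&` _ = `]a, b]%classic).
    rewrite lebesgue_measure_itv/= lte_fin; case: ltP => // ba.
    by rewrite (@le_anti _ _ a b) ?ab// subrr.
  apply/seteqP; split => x /=; first by case.
  move=> h; split => //; move: h; rewrite !in_itv/= andbT => /andP[ax _].
  exact: le_trans a0 (ltW ax).
have [b0|b0] := leP 0 b.
  rewrite subr0 (_ : _ `&` _ = `[0, b]%classic).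
    rewrite lebesgue_measure_itv/= lte_fin; case: ltP => // b1; first by rewrite oppr0 adde0.
    by rewrite (@le_anti _ _ b 0) ?b0 ?b1.
  apply/seteqP; split => x /=; rewrite !in_itv/= ?andbT; first by move=> [/andP[_ ->] ->].
  by move=> /andP[x0 ->]; rewrite x0 (lt_le_trans a0 x0).
rewrite subr0 (_ : _ `&` _ = set0) ?measure0//.
apply/seteqP; split => x //=; rewrite !in_itv/= ?andbT => -[/andP[_ xb] x0].
by have := lt_le_trans b0 (le_trans x0 xb); rewrite ltxx.
Qed.

(** Both sides agree on the half-open intervals, which generate the Borel
    sets. *)
Let pushforward_sqmod (A : set (measurableTypeR R)) : measurable A ->
  leb2 (sqmod @^-1` A) = ((fine kappa)%:E * leb (A `&` `[0%R, +oo[%classic))%E.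
Proof.
move=> mA.
have cover : \bigcup_n `]- n%:R, n%:R]%classic = [set: R].
  apply/seteqP; split => x // _; exists (Num.truncn `|x|).+1 => //=.
  rewrite in_itv/=; have := truncnS_gt `|x|.
  by rewrite real_ltr_norml ?num_real// => /andP[-> /ltW].
apply: (@measure_unique _ R (measurableTypeR R) (@ocitv R)
  (fun n => `]- n%:R, n%:R]%classic) erefl (@ocitvI R) (fun n => is_ocitv _ _) cover
  (pushforward leb2 (sqmod : plane R -> measurableTypeR R))
  (mscale (NngNum kappa_ge0) (mrestr leb (measurable_itv `[0%R, +oo[)))) => //.
- exact: measurable_sqmod.
- move=> mS _ [[a b]] _ <- /=.
  rewrite -[LHS]/(leb2 (sqmod @^-1` `]a, b]%classic)) /mscale/= /mrestr.
  have [ba|ab] := ltP b a.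
    rewrite set_itv_ge ?bnd_simp -?leNgt ?(ltW ba)// preimage_set0 set0I !measure0.
    by rewrite mule0.
  rewrite lebesgue_measure_pos_itv//.
  rewrite (_ : _ @^-1` _ = cdisk b `\` cdisk a).
    have e : (leb2 (cdisk b `\` cdisk a) = leb2 (cdisk b) - leb2 (cdisk a))%E.
      have ia : cdisk b `&` cdisk a = cdisk a.
        by rewrite setIC; apply/setIidPl => w /=; rewrite /cdisk /= => /le_trans; exact.
      rewrite -[in X in (_ - X)%E]ia; apply: measureD; [exact: measurable_cdisk..|].
      apply: le_lt_trans (ltry (Num.max b 0 * fine kappa)).
      by rewrite le_eqVlt (introT eqP (cdisk_area b)).
    by rewrite e !cdisk_area -EFinB -EFinM; congr EFin; ring.
  apply/seteqP; split => w /=; rewrite in_itv/= /cdisk/=.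
    by move=> /andP[aw ->]; split => //; apply/negP; rewrite -ltNge.
  by move=> [-> /negP]; rewrite -ltNge => ->.
- move=> mS n; rewrite -[ltLHS]/(leb2 (sqmod @^-1` `](- n%:R), n%:R]%classic)).
  apply: (@le_lt_trans _ _ (leb2 (cdisk n%:R))); last by rewrite cdisk_area ltry.
  apply: le_measure; rewrite ?inE.
  + by rewrite -[X in measurable X]setTI; apply: measurable_sqmod => //; exact: measurable_itv.
  + exact: measurable_cdisk.
  + by move=> w; rewrite /cdisk/= in_itv/= => /andP[].
Qed.

Let ge0_radial (D : set (measurableTypeR R)) (phi : R -> \bar R) :
  measurable D -> D `<=` `[0%R, +oo[%classic -> measurable_fun D phi ->
  (forall x, D x -> (0 <= phi x)%E) ->
  (\int[leb2]_(w in sqmod @^-1` D) phi (sqmod w) =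
   (fine kappa)%:E * \int[leb]_(x in D) phi x)%E.
Proof.
move=> mD D0 mphi phi0.
rewrite -(@ge0_integral_mscale _ _ _ leb D mD (NngNum kappa_ge0))//.
rewrite -(@ge0_integral_pushforward _ _ _ _ R _ measurable_sqmod leb2 D phi)//; last first.
  by move=> x /[!inE]; exact: phi0.
apply: eq_measure_integral => [|mS A mA AD]; first exact: measurable_sqmod.
rewrite -[LHS]/(leb2 (sqmod @^-1` A)) pushforward_sqmod//.
rewrite (_ : A `&` _ = A)//; apply/setIidPl; exact: subset_trans D0.
Qed.

(** The area of the unit disk is evaluated from the Gaussian integral, computed
    once by Fubini and once radially. *)
Let kappa_pi : fine kappa = pi.
Proof.
pose f := fun x : R => expR (- x).
have mf : measurable_fun [set: R] f.
  by apply: (measurableT_comp (@measurable_expR R)); exact: measurable_funN.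
have e1 : (\int[leb]_(x in `[0%R, +oo[) (f x)%:E = 1)%E.
  have dF (x : R) : is_derive x 1 (fun x => - f x) (f x).
    by apply: is_derive_eq; rewrite /GRing.scale/= mulrN1 opprK.
  apply: (etrans (@ge0_continuous_FTC2y R f (fun x => - f x) 0 0 _ _ _ _ _ _)); last first.
  - by rewrite /f oppr0 expR0 -EFinB; congr EFin; ring.
  - by move=> x _; rewrite derive1E; exact: derive_val.
  - apply: cvgN; apply: cvg_at_right_filter; apply: continuous_comp.
      exact: opp_continuous.
    exact: continuous_expR.
  - by move=> x _; apply: ex_derive.
  - by have := cvgN (@cvgr_expR R); rewrite oppr0; exact.
  - apply: continuous_subspaceT => x; apply: continuous_comp; first exact: opp_continuous.
    exact: continuous_expR.
  - by move=> x _; exact: expR_ge0.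
have mfD : measurable_fun (`[0%R, +oo[%classic : set (measurableTypeR R)) (EFin \o f).
  by apply/measurable_EFinP; exact: measurable_funTS.
have := ge0_radial (measurable_itv _) (@subset_refl _ _) mfD.
have -> : (\int[leb]_(x in `[0%R, +oo[) (EFin \o f) x = 1)%E by [].
rewrite mule1 (_ : _ @^-1` _ = setT); last first.
  by apply/seteqP; split => w //=; rewrite in_itv/= sqmod_ge0.
move=> /(_ (fun x _ => expR_ge0 _)).
rewrite (@fubini_tonelli1 _ _ _ _ R leb leb); last 2 first.
- apply/measurable_EFinP; apply: measurableT_comp => //; exact: measurable_sqmod.
- by move=> x; rewrite lee_fin expR_ge0.
rewrite /fubini_F /=.
have -> : (\int[leb]_x \int[leb]_y (f (sqmod (x, y)))%:E =
   \int[leb]_x ((gauss_fun x)%:E * (Num.sqrt pi)%:E))%E.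
  apply: eq_integral => x _.
  transitivity (\int[leb]_y ((gauss_fun x)%:E * (gauss_fun y)%:E))%E.
    by apply: eq_integral => y _; rewrite /f /sqmod /= opprD expRD EFinM.
  rewrite ge0_integralZl.
  - by congr (_ * _)%E; exact: integralT_gauss.
  - by [].
  - by apply/measurable_EFinP; exact: measurable_gauss_fun.
  - by move=> y _; rewrite lee_fin expR_ge0.
  - by rewrite lee_fin expR_ge0.
rewrite ge0_integralZr//.
- rewrite integralT_gauss -EFinM -expr2 sqr_sqrtr ?pi_ge0//.
  by case.
- by apply/measurable_EFinP; exact: measurable_gauss_fun.
- by move=> y _; rewrite lee_fin expR_ge0.
Qed.

(** Polar coordinates for radial integrands: under [dA] the square of the
    modulus is distributed like Lebesgue measure on the half-line. *)
Lemma ge0_integral_radial (D : set (measurableTypeR R)) (phi : R -> \bar R) :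
  measurable D -> D `<=` `[0%R, +oo[%classic -> measurable_fun D phi ->
  (forall x, D x -> (0 <= phi x)%E) ->
  (\int[dA R]_(w in sqmod @^-1` D) phi (sqmod w) = \int[leb]_(x in D) phi x)%E.
Proof.
move=> mD D0 mphi phi0.
have mS : measurable (sqmod @^-1` D).
  by rewrite -[X in measurable X]setTI; exact: measurable_sqmod.
rewrite ge0_integral_mscale//=.
- rewrite ge0_radial// muleA -EFinM kappa_pi mulVf ?mul1e// gt_eqF//; exact: pi_gt0.
- apply: (measurable_comp mD) => //; first by move=> _ [w Dw <-].
  by apply: measurable_funTS; exact: measurable_sqmod.
- by move=> w /= /phi0.
Qed.

Lemma dA_scales_area k T (A : set (plane R)) : scales_area k T -> measurable A ->
  dA R (T @^-1` A) = (k%:E * dA R A)%E.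
Proof.
move=> [_ h] mA; apply: (etrans (congr1 (mule (pi^-1)%:E) (h A mA))).
exact: muleCA.
Qed.

End Radial.

(** * Complex modulus; bounded functions on the disk *)

Section Complex.
Variable R : realType.
Implicit Types (z w : R[i]) (x y : R).

Lemma cReD z w : complex.Re (z + w) = complex.Re z + complex.Re w.
Proof. by case: z w => [? ?] [? ?]. Qed.
Lemma cImD z w : complex.Im (z + w) = complex.Im z + complex.Im w.
Proof. by case: z w => [? ?] [? ?]. Qed.
Lemma cReN z : complex.Re (- z) = - complex.Re z.
Proof. by case: z => [? ?]. Qed.
Lemma cImN z : complex.Im (- z) = - complex.Im z.
Proof. by case: z => [? ?]. Qed.
Lemma cReM z w : complex.Re (z * w) =
  complex.Re z * complex.Re w - complex.Im z * complex.Im w.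
Proof. by case: z w => [? ?] [? ?]. Qed.
Lemma cImM z w : complex.Im (z * w) =
  complex.Re z * complex.Im w + complex.Im z * complex.Re w.
Proof. by case: z w => [? ?] [? ?]. Qed.
Lemma cReJ z : complex.Re (conjc z) = complex.Re z.
Proof. by case: z => [? ?]. Qed.
Lemma cImJ z : complex.Im (conjc z) = - complex.Im z.
Proof. by case: z => [? ?]. Qed.
Lemma cReZ x z : complex.Re (x%:C * z) = x * complex.Re z.
Proof. by rewrite cReM/= mul0r subr0. Qed.
Lemma cImZ x z : complex.Im (x%:C * z) = x * complex.Im z.
Proof. by rewrite cImM/= mul0r addr0. Qed.
Lemma cRe_sum I (s : seq I) (P : pred I) (F : I -> R[i]) :
  complex.Re (\sum_(i <- s | P i) F i) = \sum_(i <- s | P i) complex.Re (F i).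
Proof. by elim/big_rec2: _ => // i x y _ <-; rewrite cReD. Qed.
Lemma cIm_sum I (s : seq I) (P : pred I) (F : I -> R[i]) :
  complex.Im (\sum_(i <- s | P i) F i) = \sum_(i <- s | P i) complex.Im (F i).
Proof. by elim/big_rec2: _ => // i x y _ <-; rewrite cImD. Qed.

Lemma complexRI z w : complex.Re z = complex.Re w -> complex.Im z = complex.Im w -> z = w.
Proof. by case: z w => [? ?] [? ?] /= -> ->. Qed.

Lemma modulusE z : modulus z = Num.sqrt (complex.Re z ^+ 2 + complex.Im z ^+ 2).
Proof. by case: z. Qed.
Lemma sqr_modulus z : modulus z ^+ 2 = complex.Re z ^+ 2 + complex.Im z ^+ 2.
Proof. by rewrite modulusE sqr_sqrtr// addr_ge0// sqr_ge0. Qed.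
Lemma modulus_ge0 z : 0 <= modulus z.
Proof. by rewrite modulusE sqrtr_ge0. Qed.
Lemma modulusM z w : modulus (z * w) = modulus z * modulus w.
Proof. exact: ComplexField.Normc.normcM. Qed.
Lemma modulusD z w : modulus (z + w) <= modulus z + modulus w.
Proof. exact: le_normcD. Qed.
Lemma modulusN z : modulus (- z) = modulus z.
Proof. exact: normcN. Qed.
Lemma modulusV z : modulus z^-1 = (modulus z)^-1.
Proof. exact: ComplexField.Normc.normcV. Qed.
Lemma modulus0 : modulus (0 : R[i]) = 0.
Proof. by rewrite modulusE/= expr0n/= addr0 sqrtr0. Qed.
Lemma modulus_eq0 z : modulus z = 0 -> z = 0.
Proof. exact: ComplexField.Normc.eq0_normc. Qed.
Lemma modulus1 : modulus (1 : R[i]) = 1.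
Proof. by rewrite modulusE/= expr0n/= addr0 expr1n sqrtr1. Qed.
Lemma modulusJ z : modulus (conjc z) = modulus z.
Proof. by rewrite !modulusE cReJ cImJ sqrrN. Qed.
Lemma modulus_real x : modulus x%:C = `|x|.
Proof. by rewrite modulusE/= expr0n/= addr0 sqrtr_sqr. Qed.
Lemma modulusX z n : modulus (z ^+ n) = modulus z ^+ n.
Proof. by elim: n => [|n IH]; rewrite ?expr0 ?modulus1// !exprS modulusM IH. Qed.
Lemma normr_Re_modulus z : `|complex.Re z| <= modulus z.
Proof.
rewrite -(ler_pXn2r (n := 2))// ?nnegrE ?modulus_ge0// real_normK ?num_real//.
by rewrite sqr_modulus lerDl sqr_ge0.
Qed.
Lemma normr_Im_modulus z : `|complex.Im z| <= modulus z.
Proof.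
rewrite -(ler_pXn2r (n := 2))// ?nnegrE ?modulus_ge0// real_normK ?num_real//.
by rewrite sqr_modulus lerDr sqr_ge0.
Qed.
Lemma Re_le_modulus z : complex.Re z <= modulus z.
Proof. exact: le_trans (ler_norm _) (normr_Re_modulus z). Qed.
Lemma modulus_le_ReIm z : modulus z <= `|complex.Re z| + `|complex.Im z|.
Proof.
rewrite -(ler_pXn2r (n := 2))// ?nnegrE ?modulus_ge0 ?addr_ge0// sqr_modulus.
rewrite -(real_normK (num_real (complex.Re z))) -(real_normK (num_real (complex.Im z))).
by rewrite sqrrD lerD2r lerDl mulrn_wge0// mulr_ge0.
Qed.

End Complex.

Section Bounded.
Variable R : realType.
Implicit Types (u v : plane R -> R) (h k : plane R -> R[i]) (w : plane R).

(** Bounded measurable functions on the unit disk, real and complex valued. *)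
Definition bm u : Prop :=
  measurable_fun (disk 1) u /\ exists M, forall w, disk 1 w -> `|u w| <= M.

Definition cbm h : Prop :=
  bm (fun w => complex.Re (h w)) /\ bm (fun w => complex.Im (h w)).

Lemma subset_disk (r s : R) : r <= s -> disk r `<=` disk s.
Proof. by move=> rs w /lt_le_trans; apply. Qed.

Lemma disk1_sqmod w : disk 1 w -> sqmod w < 1.
Proof. by rewrite diskE//= expr1n in_itv/= => /andP[]. Qed.

Lemma eq_bm u v : (forall w, disk 1 w -> u w = v w) -> bm u -> bm v.
Proof.
move=> uv [mu [M uM]]; split.
  by apply: eq_measurable_fun mu => w /[!inE]; exact: uv.
by exists M => w Dw; rewrite -uv//; exact: uM.
Qed.

Lemma bm_cst (c : R) : bm (fun=> c).
Proof. by split => //; exists `|c|. Qed.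

Lemma bmD u v : bm u -> bm v -> bm (fun w => u w + v w).
Proof.
move=> [mu [M uM]] [mv [N vN]]; split; first exact: measurable_funD.
by exists (M + N) => w Dw; rewrite (le_trans (ler_normD _ _))// lerD ?uM ?vN.
Qed.

Lemma bmN u : bm u -> bm (fun w => - u w).
Proof.
move=> [mu [M uM]]; split; first exact: measurable_funN.
by exists M => w Dw; rewrite normrN uM.
Qed.

Lemma bmB u v : bm u -> bm v -> bm (fun w => u w - v w).
Proof. by move=> hu hv; apply: bmD => //; exact: bmN. Qed.

Lemma bmM u v : bm u -> bm v -> bm (fun w => u w * v w).
Proof.
move=> [mu [M uM]] [mv [N vN]]; split; first exact: measurable_funM.
by exists (M * N) => w Dw; rewrite normrM ler_pM ?uM ?vN.
Qed.

Lemma bmZ c u : bm u -> bm (fun w => c * u w).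
Proof. by move=> hu; apply: bmM => //; exact: bm_cst. Qed.

Lemma bmX u n : bm u -> bm (fun w => u w ^+ n).
Proof.
move=> hu; elim: n => [|n IH].
  by apply: eq_bm (bm_cst 1) => w _; rewrite expr0.
by apply: eq_bm (bmM hu IH) => w _; rewrite exprS.
Qed.

Lemma bm_sum I (s : seq I) (P : pred I) (F : I -> plane R -> R) :
  (forall i, P i -> bm (F i)) -> bm (fun w => \sum_(i <- s | P i) F i w).
Proof.
move=> hF; elim: s => [|i s IH].
  by apply: eq_bm (bm_cst 0) => w _; rewrite big_nil.
have [Pi|Pi] := boolP (P i).
  by apply: eq_bm (bmD (hF i Pi) IH) => w _; rewrite big_cons Pi.
by apply: eq_bm IH => w _; rewrite big_cons (negPf Pi).
Qed.

Lemma bm_indic (A : set (plane R)) : measurable A -> bm (\1_A).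
Proof.
move=> mA; split; first exact: measurable_indic.
by exists 1 => w _; rewrite indicE; case: (w \in A); rewrite ?normr1 ?normr0.
Qed.

Lemma bm_fst : bm (fun w => w.1).
Proof.
split; first exact: measurable_funTS measurable_fst.
exists 1 => w Dw; rewrite -(expr_le1 (n := 2))// real_normK ?num_real//.
by rewrite (le_trans _ (ltW (disk1_sqmod Dw)))// lerDl sqr_ge0.
Qed.

Lemma bm_snd : bm (fun w => w.2).
Proof.
split; first exact: measurable_funTS measurable_snd.
exists 1 => w Dw; rewrite -(expr_le1 (n := 2))// real_normK ?num_real//.
by rewrite (le_trans _ (ltW (disk1_sqmod Dw)))// lerDr sqr_ge0.
Qed.

Lemma bm_sqmod : bm (@sqmod R).
Proof. by apply: bmD; apply: bmX; [exact: bm_fst|exact: bm_snd]. Qed.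

Lemma bm_sqrt u : bm u -> bm (fun w => Num.sqrt (u w)).
Proof.
move=> [mu [M uM]]; split.
  apply: (measurableT_comp (f := @Num.sqrt R)) => //.
  exact: continuous_measurable_fun (@sqrt_continuous R).
exists (Num.sqrt M) => w Dw; rewrite ger0_norm ?sqrtr_ge0//.
rewrite ler_wsqrtr//; exact: le_trans (ler_norm _) (uM w Dw).
Qed.

Lemma cbm_cst (c : R[i]) : cbm (fun=> c).
Proof. by split; exact: bm_cst. Qed.

Lemma eq_cbm h k : (forall w, disk 1 w -> h w = k w) -> cbm h -> cbm k.
Proof. by move=> hk [h1 h2]; split; [apply: eq_bm h1|apply: eq_bm h2] => w /hk ->. Qed.

Lemma cbmD h k : cbm h -> cbm k -> cbm (fun w => h w + k w).
Proof.
by move=> [h1 h2] [k1 k2]; split; [apply: eq_bm (bmD h1 k1)|apply: eq_bm (bmD h2 k2)] => w _;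
  rewrite ?cReD ?cImD.
Qed.

Lemma cbmN h : cbm h -> cbm (fun w => - h w).
Proof.
by move=> [h1 h2]; split; [apply: eq_bm (bmN h1)|apply: eq_bm (bmN h2)] => w _;
  rewrite ?cReN ?cImN.
Qed.

Lemma cbmM h k : cbm h -> cbm k -> cbm (fun w => h w * k w).
Proof.
move=> [h1 h2] [k1 k2]; split.
  by apply: eq_bm (bmB (bmM h1 k1) (bmM h2 k2)) => w _; rewrite cReM.
by apply: eq_bm (bmD (bmM h1 k2) (bmM h2 k1)) => w _; rewrite cImM.
Qed.

Lemma cbmJ h : cbm h -> cbm (fun w => conjc (h w)).
Proof.
move=> [h1 h2]; split; first by apply: eq_bm h1 => w _; rewrite cReJ.
by apply: eq_bm (bmN h2) => w _; rewrite cImJ.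
Qed.

Lemma cbmX h n : cbm h -> cbm (fun w => h w ^+ n).
Proof.
move=> hu; elim: n => [|n IH].
  by apply: eq_cbm (cbm_cst 1) => w _; rewrite expr0.
by apply: eq_cbm (cbmM hu IH) => w _; rewrite exprS.
Qed.

Lemma cbm_sum I (s : seq I) (P : pred I) (F : I -> plane R -> R[i]) :
  (forall i, P i -> cbm (F i)) -> cbm (fun w => \sum_(i <- s | P i) F i w).
Proof.
move=> hF; split.
  by under eq_fun do rewrite cRe_sum; apply: bm_sum => i /hF[].
by under eq_fun do rewrite cIm_sum; apply: bm_sum => i /hF[].
Qed.

Lemma cbm_cplx : cbm (@cplx R).
Proof. by split; [exact: bm_fst|exact: bm_snd]. Qed.

Lemma bm_sqr_modulus h : cbm h -> bm (fun w => modulus (h w) ^+ 2).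
Proof.
move=> [h1 h2]; apply: eq_bm (bmD (bmX 2 h1) (bmX 2 h2)) => w _.
by rewrite sqr_modulus.
Qed.

Lemma bm_modulus h : cbm h -> bm (fun w => modulus (h w)).
Proof.
move=> /bm_sqr_modulus/bm_sqrt; apply: eq_bm => w _.
by rewrite sqrtr_sqr ger0_norm// modulus_ge0.
Qed.

Lemma cbm_bounded h : measurable_on_disk h ->
  (exists M, forall w, disk 1 w -> modulus (h w) <= M) -> cbm h.
Proof.
move=> [m1 m2] [M hM]; split; split=> //; exists M => w Dw.
  exact: le_trans (normr_Re_modulus _) (hM w Dw).
exact: le_trans (normr_Im_modulus _) (hM w Dw).
Qed.

(** Integral over the disk of radius [r]. *)
Definition bint (r : R) u : R := \int[dA R]_(w in disk r) u w.

Local Notation mdisk := (@measurable_disk R).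

Lemma dA_diskE (r : R) : 0 <= r -> dA R (disk r) = (r ^+ 2)%:E.
Proof.
move=> r0.
have := @ge0_integral_radial R `[0, (r ^+ 2)[ (cst 1%E) (measurable_itv _).
rewrite (_ : _ @^-1` _ = disk r); last by rewrite diskE.
rewrite !integral_cst//; last exact: mdisk.
rewrite !mul1e => -> //.
  apply: (etrans (lebesgue_measure_itv _)); rewrite /= lte_fin; case: ltP => h; first by rewrite oppr0 adde0.
  by rewrite (@le_anti _ _ (r ^+ 2) 0)// h sqr_ge0.
by move=> x /=; rewrite !in_itv/= => /andP[->].
Qed.

Lemma dA_disk_lty (r : R) : r <= 1 -> (dA R (disk r) < +oo)%E.
Proof.
move=> r1; apply: (@le_lt_trans _ _ (dA R (disk 1))); last by rewrite dA_diskE ?ltry.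
by apply: le_measure; rewrite ?inE//; [exact: mdisk|exact: mdisk|exact: subset_disk].
Qed.

Lemma bm_integrable u (r : R) : bm u -> r <= 1 -> (dA R).-integrable (disk r) (EFin \o u).
Proof.
move=> [mu [M uM]] r1.
apply: measurable_bounded_integrable; [exact: mdisk|exact: dA_disk_lty| |].
  exact: measurable_funS (mdisk 1) (subset_disk r1) mu.
exists M; split; first exact: num_real.
by move=> x Mx w Dw; exact: le_trans (uM w (subset_disk r1 Dw)) (ltW Mx).
Qed.

Lemma eq_bint (r : R) u v : (forall w, disk r w -> u w = v w) -> bint r u = bint r v.
Proof. by move=> uv; apply: eq_Rintegral => w /[!inE]; exact: uv. Qed.

Lemma bintD (r : R) u v : r <= 1 -> bm u -> bm v ->
  bint r (fun w => u w + v w) = bint r u + bint r v.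
Proof.
by move=> r1 hu hv; apply: RintegralD; [exact: mdisk|exact: bm_integrable..].
Qed.

Lemma bintB (r : R) u v : r <= 1 -> bm u -> bm v ->
  bint r (fun w => u w - v w) = bint r u - bint r v.
Proof.
by move=> r1 hu hv; apply: RintegralB; [exact: mdisk|exact: bm_integrable..].
Qed.

Lemma bintZ (r : R) c u : r <= 1 -> bm u -> bint r (fun w => c * u w) = c * bint r u.
Proof.
by move=> r1 hu; apply: RintegralZl; [exact: mdisk|exact: bm_integrable].
Qed.

Lemma bint0 (r : R) : bint r (fun=> 0) = 0.
Proof. by rewrite /bint Rintegral_cst ?mul0r//; exact: mdisk. Qed.

Lemma bint_sum (r : R) I (s : seq I) (P : pred I) (F : I -> plane R -> R) : r <= 1 ->
  (forall i, P i -> bm (F i)) ->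
  bint r (fun w => \sum_(i <- s | P i) F i w) = \sum_(i <- s | P i) bint r (F i).
Proof.
move=> r1 hF; elim: s => [|i s IH].
  by rewrite big_nil -[RHS](bint0 r); apply: eq_bint => w _; rewrite big_nil.
rewrite big_cons; case: ifPn => Pi.
  rewrite -IH -bintD//; [|exact: hF|exact: bm_sum].
  by apply: eq_bint => w _; rewrite big_cons Pi.
by rewrite -IH; apply: eq_bint => w _; rewrite big_cons (negPf Pi).
Qed.

Lemma le_bint (r : R) u v : r <= 1 -> bm u -> bm v ->
  (forall w, disk r w -> u w <= v w) -> bint r u <= bint r v.
Proof.
by move=> r1 hu hv uv; apply: le_Rintegral => //; [exact: mdisk|exact: bm_integrable..].
Qed.

Lemma bint_ge0 (r : R) u : (forall w, disk r w -> 0 <= u w) -> 0 <= bint r u.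
Proof. exact: Rintegral_ge0. Qed.

Lemma bint_cst (r c : R) : 0 <= r -> bint r (fun=> c) = c * r ^+ 2.
Proof. by move=> r0; rewrite /bint Rintegral_cst ?dA_diskE//; exact: mdisk. Qed.

Lemma bint_EFin (r : R) u : r <= 1 -> bm u ->
  (\int[dA R]_(w in disk r) (u w)%:E)%E = (bint r u)%:E.
Proof.
move=> r1 hu; rewrite /bint /Rintegral fineK//.
by apply: integrable_fin_num; [exact: mdisk|exact: bm_integrable].
Qed.

Lemma bint_indic (r s : R) u : r <= s ->
  bint s (fun w => \1_(disk r) w * u w) = bint r u.
Proof.
move=> rs; have -> : disk r = disk s `&` disk r.
  by apply/esym; apply/setIidPr; exact: subset_disk.
rewrite {2}/bint; rewrite (_ : disk s `&` disk r = disk r); last first.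
  by apply/setIidPr; exact: subset_disk.
rewrite -[in RHS](_ : disk s `&` disk r = disk r); last first.
  by apply/setIidPr; exact: subset_disk.
rewrite Rintegral_mkcondr; apply: eq_Rintegral => w _.
rewrite patchE indicE; case: ifPn => _; by rewrite ?mul1r ?mul0r.
Qed.

Lemma bint_norm_le (r M : R) u : 0 <= r <= 1 -> 0 <= M -> bm u ->
  (forall w, disk r w -> `|u w| <= M) -> `|bint r u| <= M.
Proof.
move=> /andP[r0 r1] M0 hu uM; have r21 : r ^+ 2 <= 1 by rewrite expr_le1.
have hM : M * r ^+ 2 <= M by rewrite ler_piMr.
rewrite ler_norml; apply/andP; split.
  apply: (@le_trans _ _ (bint r (fun=> - M))); first by rewrite bint_cst// mulNr lerN2.
  apply: le_bint => //; first exact: bm_cst.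
  by move=> w /uM; rewrite ler_norml => /andP[].
apply: (@le_trans _ _ (bint r (fun=> M))); last by rewrite bint_cst.
apply: le_bint => //; first exact: bm_cst.
by move=> w /uM; rewrite ler_norml => /andP[].
Qed.

End Bounded.

(** * Changes of variables and Parseval identities *)

Section Transforms.
Variable R : realType.
Implicit Types (u v : plane R -> R) (h k : plane R -> R[i]) (w : plane R).

(** Measurability on the whole plane, needed to change variables; [bm] and [cbm]
    only refer to the unit disk. *)
Definition measT h : Prop :=
  measurable_fun [set: plane R] (fun w => complex.Re (h w)) /\
  measurable_fun [set: plane R] (fun w => complex.Im (h w)).

Lemma measT_cst (c : R[i]) : measT (fun=> c).
Proof. by []. Qed.

Lemma measTD h k : measT h -> measT k -> measT (fun w => h w + k w).
Proof.
move=> [h1 h2] [k1 k2]; split.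
  by under eq_fun do rewrite cReD; exact: measurable_funD.
by under eq_fun do rewrite cImD; exact: measurable_funD.
Qed.

Lemma measTM h k : measT h -> measT k -> measT (fun w => h w * k w).
Proof.
move=> [h1 h2] [k1 k2]; split.
  under eq_fun do rewrite cReM.
  by apply: measurable_funB; exact: measurable_funM.
under eq_fun do rewrite cImM.
by apply: measurable_funD; exact: measurable_funM.
Qed.

Lemma measTJ h : measT h -> measT (fun w => conjc (h w)).
Proof.
move=> [h1 h2]; split; first by under eq_fun do rewrite cReJ.
by under eq_fun do rewrite cImJ; exact: measurable_funN.
Qed.

Lemma measTX h n : measT h -> measT (fun w => h w ^+ n).
Proof.
move=> hh; elim: n => [|n IH].
  by under eq_fun do rewrite expr0; exact: measT_cst.
by under eq_fun do rewrite exprS; exact: measTM.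
Qed.

Lemma measT_cplx : measT (@cplx R).
Proof. by split; [exact: measurable_fst|exact: measurable_snd]. Qed.

Lemma measT_sum I (s : seq I) (F : I -> plane R -> R[i]) :
  (forall i, measT (F i)) -> measT (fun w => \sum_(i <- s) F i w).
Proof.
move=> hF; elim: s => [|i s IH].
  by under eq_fun do rewrite big_nil; exact: measT_cst.
by under eq_fun do rewrite big_cons; exact: measTD.
Qed.

Lemma measT_modulus h : measT h -> measurable_fun [set: plane R] (fun w => modulus (h w)).
Proof.
move=> [h1 h2]; under eq_fun do rewrite modulusE.
apply: (measurableT_comp (f := @Num.sqrt R)).
  exact: continuous_measurable_fun (@sqrt_continuous R).
by apply: measurable_funD; exact: measurable_funX.
Qed.

Lemma integral_scales_area (T : plane R -> plane R) (D : set (plane R)) (u : plane R -> \bar R) :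
  scales_area 1 T -> measurable D -> measurable_fun [set: plane R] u ->
  (dA R).-integrable (T @^-1` D) (u \o T) ->
  (\int[dA R]_(w in T @^-1` D) u (T w) = \int[dA R]_(w in D) u w)%E.
Proof.
move=> sT mD mu iu; have mT := sT.1.
apply: (etrans (esym (integral_pushforward mT mu iu mD))).
apply: eq_measure_integral => A mA _.
by apply: (etrans (dA_scales_area sT mA)); rewrite mul1e.
Qed.

Lemma ge0_integral_scales_area (k : R) (T : plane R -> plane R) (D : set (plane R))
    (u : plane R -> \bar R) :
  0 <= k -> scales_area k T -> measurable D -> measurable_fun D u ->
  (forall w, D w -> (0 <= u w)%E) ->
  (\int[dA R]_(w in T @^-1` D) u (T w) = k%:E * \int[dA R]_(w in D) u w)%E.
Proof.
move=> k0 sT mD mu u0; have mT := sT.1.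
have u0' : {in D, forall w, (0 <= u w)%E} by move=> w /[!inE]; exact: u0.
apply: (etrans (esym (ge0_integral_pushforward mT (dA R) mD mu u0'))).
apply: (etrans _ (ge0_integral_mscale (dA R) mD (NngNum k0) mu u0)).
apply: eq_measure_integral => A mA _.
exact: (dA_scales_area sT mA).
Qed.

Lemma cplx_dilate (t : R) w : cplx (dilate_plane t w) = t%:C * cplx w.
Proof. by apply: complexRI; rewrite ?cReZ ?cImZ. Qed.

Lemma disk_dilate (t r : R) : 0 < t -> dilate_plane t @^-1` disk (t * r) = disk r.
Proof.
move=> t0; apply/funext => w; rewrite /disk /preimage /mkset cplx_dilate modulusM.
by rewrite modulus_real gtr0_norm// ltr_pM2l.
Qed.

(** Change of variables [z = t w] in an area integral. *)
Lemma bint_dilate (t r : R) u : 0 < t <= 1 -> r <= 1 -> bm u ->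
  (forall w, disk 1 w -> 0 <= u w) ->
  bint (t * r) u = t ^+ 2 * bint r (fun w => u (dilate_plane t w)).
Proof.
move=> /andP[t0 t1] r1 hu u0.
have tr1 : t * r <= 1.
  have [r0|r0] := leP 0 r; first by rewrite mulr_ile1// ltW.
  by rewrite (le_trans _ ler01)// mulr_ge0_le0// ltW.
have := @ge0_integral_scales_area (t ^- 2) (dilate_plane t) (disk (t * r)) (EFin \o u) _
  (scales_area_dilation t0) (@measurable_disk R _).
rewrite disk_dilate// => H.
rewrite /bint /Rintegral H.
- rewrite fineM//; first by rewrite /= mulrA mulfV ?mul1r// expf_neq0// gt_eqF.
  by apply: integrable_fin_num; [exact: measurable_disk|exact: bm_integrable].
- by rewrite invr_ge0 exprn_ge0// ltW.
- apply/measurable_EFinP; case: hu => mu _.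
  exact: measurable_funS (measurable_disk 1) (subset_disk tr1) mu.
- by move=> w /(subset_disk tr1) Dw; rewrite lee_fin u0.
Qed.

Lemma sqmod_cplx w : sqmod w = modulus (cplx w) ^+ 2.
Proof. by rewrite sqmod_modulus. Qed.

Lemma cplx_rotate (c s : R) w : cplx (rotate_plane c s w) = (c +i* s) * cplx w.
Proof. by apply: complexRI; rewrite ?cReM ?cImM/=; ring. Qed.

(** Area integrals over the unit disk are invariant under [w |-> e ^+ 2 * w]. *)
Lemma bint_rotate (e : R[i]) u : modulus e = 1 -> 1 + complex.Re e != 0 ->
  measurable_fun [set: plane R] u -> bm u ->
  exists2 T : plane R -> plane R, (forall w, cplx (T w) = e ^+ 2 * cplx w) &
    bint 1 (fun w => u (T w)) = bint 1 u.
Proof.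
case: e => c s m1 c1 mu hu; pose T0 := rotate_plane c s; pose T := T0 \o T0.
have s0 : scales_area 1 T0.
  by apply: scales_area_rotation => //; rewrite -[RHS](expr1n _ 2) -m1 sqr_modulus.
have sT : scales_area 1 T by rewrite -[1]mulr1; exact: scales_area_comp.
have eT w : cplx (T w) = (c +i* s) ^+ 2 * cplx w.
  by rewrite /T/= !cplx_rotate mulrA expr2.
exists T => //.
have TD : T @^-1` disk 1 = disk 1.
  apply/funext => w; rewrite /disk /preimage /mkset eT modulusM modulusX.
  by rewrite m1 expr1n mul1r.
rewrite /bint /Rintegral -[in LHS]TD.
rewrite (@integral_scales_area T (disk 1) (EFin \o u))//.
- exact: measurable_disk.
- exact/measurable_EFinP.
- rewrite TD; apply: (@bm_integrable _ (u \o T)) => //; split.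
    by apply: measurable_funTS; apply: measurableT_comp => //; case: sT.
  case: hu => _ [M uM]; exists M => w Dw; apply: uM.
  by move: Dw; rewrite -[in X in X -> _]TD.
Qed.

End Transforms.

Section Expansions.
Variable R : realType.
Implicit Types (z : R[i]) (x t : R).

Lemma FTC2_is_derive (f F : R -> R) (a b : R) : a < b ->
  (forall x, a <= x <= b -> is_derive x 1 F (f x)) ->
  (forall x, a <= x <= b -> {for x, continuous f}) ->
  (\int[lebesgue_measure]_(x in `[a, b]) (f x)%:E)%E = (F b - F a)%:E.
Proof.
move=> ab dF cf.
have cF x : a <= x <= b -> {for x, continuous F}.
  move=> /dF dFx; apply: differentiable_continuous; apply/derivable1_diffP.
  exact: ex_derive.
rewrite (@continuous_FTC2 _ f F a b)//.
- apply: continuous_in_subspaceT => x; rewrite inE/= in_itv/=; exact: cf.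
- split.
  + by move=> x; rewrite in_itv/= => /andP[ax xb]; have := dF x; rewrite !ltW// => /(_ isT) ?; exact: ex_derive.
  + by apply: cvg_at_right_filter; apply: cF; rewrite lexx ltW.
  + by apply: cvg_at_left_filter; apply: cF; rewrite lexx ltW.
- move=> x; rewrite in_itv/= => /andP[ax xb]; rewrite derive1E.
  by have := dF x; rewrite !ltW// => /(_ isT) ?; exact: derive_val.
Qed.

(** Radial area integrals through a primitive in the squared modulus. *)
Lemma radial_primitive (r : R) (f F : R -> R) : 0 < r ->
  (forall x, 0 <= x <= r ^+ 2 -> 0 <= f x) ->
  (forall x, 0 <= x <= r ^+ 2 -> is_derive x 1 F (f x)) ->
  (forall x, 0 <= x <= r ^+ 2 -> {for x, continuous f}) ->
  (\int[dA R]_(w in disk r) (f (sqmod w))%:E)%E = (F (r ^+ 2) - F 0)%:E.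
Proof.
move=> r0 f0 dF cf; have r2 : 0 < r ^+ 2 by rewrite exprn_gt0.
have mf : measurable_fun (`[0, r ^+ 2]%classic : set R) f.
  apply: subspace_continuous_measurable_fun => //.
  by apply: continuous_in_subspaceT => x; rewrite inE/= in_itv/=; exact: cf.
have mf' : measurable_fun (`[0, r ^+ 2[%classic : set R) f.
  apply: measurable_funS mf => //; apply: subset_itvl; by rewrite bnd_simp.
rewrite diskE ?(ltW r0)// (@ge0_integral_radial R `[0, (r ^+ 2)[ (EFin \o f)).
- rewrite -(FTC2_is_derive r2 dF cf); apply: integral_itv_bndo_bndc.
  exact/measurable_EFinP.
- exact: measurable_itv.
- by move=> x /=; rewrite !in_itv/= => /andP[->].
- exact/measurable_EFinP.
- by move=> x /=; rewrite in_itv/= => /andP[x0 xr]; rewrite lee_fin f0// x0 ltW.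
Qed.

Lemma integral_disk_weight (r : R) : 0 < r < 1 ->
  (\int[dA R]_(w in disk r) ((1 - sqmod w)^-1)%:E)%E = (log_weight r)%:E.
Proof.
move=> /andP[r0 r1].
have r21 : r ^+ 2 < 1 by rewrite expr_lt1// ltW.
have d1 x : 0 <= x <= r ^+ 2 -> 0 < 1 - x by move=> /andP[_ xr]; rewrite subr_gt0 (le_lt_trans xr).
have dI x : 0 <= x <= r ^+ 2 -> is_derive x 1 (fun x => (1 - x)^-1) ((1 - x)^-2).
  move=> /d1 x1; have ? : 1 - x != 0 by rewrite gt_eqF.
  apply: is_derive_eq; rewrite /GRing.scale/=; field; by rewrite gt_eqF.
have f0 x : 0 <= x <= r ^+ 2 -> 0 <= (1 - x)^-1 by move=> /d1 x1; rewrite invr_ge0 ltW.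
have dF x : 0 <= x <= r ^+ 2 -> is_derive x 1 (fun x => - ln (1 - x)) (1 - x)^-1.
  move=> /d1 x1; have ? := is_derive1_ln x1.
  by apply: is_derive_eq; rewrite /GRing.scale/=; ring.
have cf x : 0 <= x <= r ^+ 2 -> {for x, continuous (fun x : R => (1 - x)^-1)}.
  move=> /dI dx; apply: differentiable_continuous; apply/derivable1_diffP.
  exact: ex_derive.
rewrite (radial_primitive r0 f0 dF cf).
by rewrite subr0 ln1 oppr0 subr0 /log_weight div1r lnV// posrE subr_gt0.
Qed.

Lemma is_derive_exprn (n : nat) x :
  is_derive x 1 (fun y : R => y ^+ n.+1) (n.+1%:R * x ^+ n).
Proof.
have := @is_deriveX R R id n.+1 x 1 1 (is_derive_id _ _).
by rewrite exprfctE /GRing.scale/= mulr1.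
Qed.

Lemma weighted_moment (n : nat) :
  bint 1 (fun w : plane R => (1 - sqmod w) * sqmod w ^+ n) = (n.+1%:R * n.+2%:R)^-1 :> R.
Proof.
pose f (x : R) := (1 - x) * x ^+ n.
pose F (x : R) := n.+1%:R^-1 * x ^+ n.+1 - n.+2%:R^-1 * x ^+ n.+2.
have f0 x : 0 <= x <= 1 ^+ 2 -> 0 <= f x.
  by move=> /andP[x0]; rewrite expr1n => x1; rewrite mulr_ge0 ?exprn_ge0 ?subr_ge0.
have dF x : 0 <= x <= 1 ^+ 2 -> is_derive x 1 F (f x).
  move=> _; have d1 := is_derive_exprn n x; have d2 := is_derive_exprn n.+1 x.
  rewrite /F; apply: is_derive_eq; rewrite /GRing.scale/= /f.
  rewrite !mulrA !mulVf ?pnatr_eq0// !mul1r.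
  by rewrite exprS; ring.
have cf x : 0 <= x <= 1 ^+ 2 -> {for x, continuous f}.
  move=> _; apply: cvgM; first by apply: cvgB; [exact: cvg_cst|exact: cvg_id].
  exact: exprn_continuous.
rewrite /bint /Rintegral (radial_primitive ltr01 f0 dF cf)/=.
rewrite /F !expr1n !expr0n/= !mulr0 subr0 !mulr1 subr0.
have a0 : n.+1%:R != 0 :> R by rewrite pnatr_eq0.
have b0 : n.+2%:R != 0 :> R by rewrite pnatr_eq0.
move: a0 b0; rewrite -[n.+2]addn1 natrD; move: (n.+1%:R : R) => a a0 b0.
by field; rewrite a0 b0.
Qed.

(** The polynomial with coefficients [a 0, ..., a (N-1)]. *)
Definition psum (a : nat -> R[i]) (N : nat) (z : R[i]) : R[i] :=
  \sum_(n < N) a n * z ^+ n.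

Lemma sqr_modulusE z : modulus z ^+ 2 = complex.Re (z * conjc z).
Proof. by rewrite sqr_modulus cReM cReJ cImJ; ring. Qed.

Lemma sqr_modulus_sum (N : nat) (x : 'I_N -> R[i]) :
  modulus (\sum_(n < N) x n) ^+ 2 =
  \sum_(n < N) \sum_(m < N) complex.Re (x n * conjc (x m)).
Proof.
rewrite sqr_modulusE rmorph_sum/= mulr_suml cRe_sum.
by apply: eq_bigr => n _; rewrite mulr_sumr cRe_sum.
Qed.

Lemma deMoivre x (n : nat) :
  (cos x +i* sin x) ^+ n = cos (n%:R * x) +i* sin (n%:R * x).
Proof.
elim: n => [|n IH]; first by rewrite expr0 mul0r cos0 sin0.
rewrite exprS IH -natr1 mulrDl mul1r addrC cosD sinD.
by apply: complexRI; rewrite ?cReM ?cImM/=; ring.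
Qed.

Lemma modulus_cis x : modulus (cos x +i* sin x) = 1.
Proof. by rewrite modulusE/= cos2Dsin2 sqrtr1. Qed.

Lemma mul_conj_unit z : modulus z = 1 -> z * conjc z = 1.
Proof.
move=> z1; apply: complexRI; first by rewrite -sqr_modulusE z1 expr1n.
by rewrite cImM cReJ cImJ/=; ring.
Qed.

(** Here [maxn n m - minn n m] is the distance between [n] and [m]. *)
Lemma exprM_unit_antipode (e f : R[i]) (n m : nat) : e * f = 1 -> n != m ->
  e ^+ (maxn n m - minn n m) = -1 -> f ^+ (maxn n m - minn n m) = -1 ->
  e ^+ n * f ^+ m = -1.
Proof.
move=> ef nm; have ee j : e ^+ j * f ^+ j = 1 by rewrite -exprMn ef expr1n.
rewrite /maxn /minn; case: (ltngtP n m) nm => //= h _ ek fk.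
- by rewrite -(subnKC (ltnW h)) exprD mulrA ee mul1r.
- by rewrite -(subnKC (ltnW h)) exprD mulrAC ee mul1r.
Qed.

(** A rotation by [e ^+ 2], where [e ^+ 2] raised to the power [|n - m|] is
    [-1], changes the sign of the integrand. *)
Lemma cplx_orthogonal (a : R[i]) (n m : nat) : n != m ->
  bint 1 (fun w => (1 - sqmod w) *
    complex.Re (a * (cplx w ^+ n * conjc (cplx w ^+ m)))) = 0.
Proof.
move=> nm; pose k := (maxn n m - minn n m)%N.
have k0 : (0 < k)%N by rewrite /k /maxn /minn; case: (ltngtP n m) nm => //= h _; rewrite subn_gt0.
have kR : (0 : R) < k%:R by rewrite ltr0n.
(* the square of [e] has argument [pi / k]; halving the angle excludes the
   half turn, to which [bint_rotate] does not apply *)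
pose x : R := pi / 2 / k%:R.
have x0 : 0 < x by rewrite divr_gt0// divr_gt0// pi_gt0.
have xpi : x <= pi / 2.
  by rewrite /x ler_pdivrMr// ler_peMr ?ler1n// ltW// divr_gt0// pi_gt0.
pose e : R[i] := cos x +i* sin x.
have e1 : modulus e = 1 := modulus_cis x.
have ek : (e ^+ 2) ^+ k = -1.
  rewrite -exprM deMoivre natrM.
  have -> : 2 * k%:R * x = pi by rewrite /x; field; rewrite gt_eqF.
  by rewrite cospi sinpi; apply: complexRI; rewrite ?cReN ?cImN/= ?oppr0.
have ek' : (conjc e ^+ 2) ^+ k = -1.
  have -> : (conjc e ^+ 2) ^+ k = conjc ((e ^+ 2) ^+ k) by rewrite !rmorphXn.
  by rewrite ek rmorphN rmorph1.
have ce : 1 + complex.Re e != 0.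
  rewrite gt_eqF// ltr_pwDl// cos_ge0_pihalf// xpi andbT.
  by rewrite (le_trans _ (ltW x0))// oppr_le0 divr_ge0// pi_ge0.
pose u (w : plane R) := (1 - sqmod w) *
    complex.Re (a * (cplx w ^+ n * conjc (cplx w ^+ m))).
have ch : cbm (fun w => a * (cplx w ^+ n * conjc (cplx w ^+ m))).
  apply: cbmM (cbm_cst _) _; apply: cbmM; last apply: cbmJ; apply: cbmX; exact: cbm_cplx.
have hu : bm u.
  by apply: bmM; [apply: bmB (bm_cst _) _; exact: bm_sqmod|case: ch].
have mu : measurable_fun [set: plane R] u.
  apply: measurable_funM.
    by apply: measurable_funB => //; exact: measurable_sqmod.
  have : measT (fun w => a * (cplx w ^+ n * conjc (cplx w ^+ m))).
    apply: measTM (measT_cst _) _; apply: measTM; last apply: measTJ;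
    apply: measTX; exact: measT_cplx.
  by case.
have [T eT iT] := bint_rotate e1 ce mu hu.
have uT w : u (T w) = - u w.
  rewrite /u sqmod_cplx eT modulusM modulusX e1 expr1n mul1r -sqmod_cplx -mulrN -cReN.
  congr (_ * complex.Re _); rewrite -mulrN; congr (_ * _).
  have -> : conjc ((e ^+ 2 * cplx w) ^+ m) = (conjc e ^+ 2) ^+ m * conjc (cplx w ^+ m).
    by rewrite exprMn rmorphM !rmorphXn.
  rewrite exprMn.
  have key : (e ^+ 2) ^+ n * (conjc e ^+ 2) ^+ m = -1.
    apply: exprM_unit_antipode nm ek ek'.
    by rewrite -exprMn (mul_conj_unit e1) expr1n.
  by rewrite mulrACA key mulN1r.
rewrite -[LHS]/(bint 1 u); move: (u) (T) hu uT iT => v S hv vS iS.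
have : bint 1 (fun w => v (S w)) = - bint 1 v.
  apply: (etrans (eq_bint (v := fun w => -1 * v w) _)).
    by move=> w _; rewrite vS mulN1r.
  by rewrite (bintZ (-1) (lexx 1) hv) mulN1r.
rewrite iS => h; have : bint 1 v + bint 1 v = 0 by rewrite {1}h addNr.
by rewrite -mulr2n => /eqP; rewrite mulrn_eq0/= => /eqP.
Qed.

Lemma cbm_psum (a : nat -> R[i]) N : cbm (fun w => psum a N (cplx w)).
Proof.
apply: cbm_sum => n _; apply: cbmM (cbm_cst _) _; apply: cbmX; exact: cbm_cplx.
Qed.

(** Parseval's identity for the weight [1 - |w|^2] on the unit disk. *)
Lemma parseval_disk (a : nat -> R[i]) N :
  bint 1 (fun w => (1 - sqmod w) * modulus (psum a N (cplx w)) ^+ 2) =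
  \sum_(n < N) modulus (a n) ^+ 2 / (n.+1%:R * n.+2%:R).
Proof.
pose G (n m : 'I_N) (w : plane R) := (1 - sqmod w) *
    complex.Re ((a n * conjc (a m)) * (cplx w ^+ n * conjc (cplx w ^+ m))).
have hG n m : bm (G n m).
  apply: bmM; first by apply: bmB (bm_cst _) _; exact: bm_sqmod.
  have : cbm (fun w => (a n * conjc (a m)) * (cplx w ^+ n * conjc (cplx w ^+ m))).
    apply: cbmM (cbm_cst _) _; apply: cbmM; last apply: cbmJ; apply: cbmX; exact: cbm_cplx.
  by case.
transitivity (bint 1 (fun w => \sum_(n < N) \sum_(m < N) G n m w)).
  apply: eq_bint => w _; rewrite sqr_modulus_sum mulr_sumr; apply: eq_bigr => n _.
  rewrite mulr_sumr; apply: eq_bigr => m _; congr (_ * complex.Re _).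
  by rewrite rmorphM/= mulrACA.
rewrite bint_sum//; last by move=> n _; exact: bm_sum.
apply: eq_bigr => n _; rewrite bint_sum// (bigD1 n)//= big1 ?addr0; last first.
  by move=> m mn; apply: cplx_orthogonal; rewrite eq_sym; exact: mn.
rewrite -weighted_moment -bintZ//; last first.
  by apply: bmM; [apply: bmB (bm_cst _) _|apply: bmX]; exact: bm_sqmod.
apply: eq_bint => w _; rewrite /G [RHS]mulrCA; congr (_ * _).
have e z : z * conjc z = (modulus z ^+ 2)%:C.
  apply: complexRI; first by rewrite -sqr_modulusE.
  by rewrite cImM cReJ cImJ/=; ring.
by rewrite !e cReZ/= modulusX sqmod_cplx -!exprM mulnC.
Qed.

Lemma continuous_big_sum (N : nat) (h : 'I_N -> R -> R) :
  (forall i, continuous (h i)) -> continuous (fun t => \sum_(i < N) h i t).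
Proof.
move=> hc; rewrite (_ : (fun _ => _) = \sum_(i < N) h i); last first.
  by apply/funext => t; rewrite fct_sumE.
elim/big_ind: _ => [|f g cf cg|i _] t; last exact: hc.
- exact: cst_continuous.
- by apply: continuousD; [exact: cf|exact: cg].
Qed.

(** The primitive takes the same value at both ends of the period unless the
    two frequencies agree. *)
Lemma trig_orthogonal (c : R[i]) (n m : nat) :
  let f t := complex.Re (c * ((cos t +i* sin t) ^+ n *
     conjc ((cos t +i* sin t) ^+ m))) in
  continuous f /\ exists2 F : R -> R, (forall t, is_derive t 1 F (f t)) &
  F (2 * pi) - F 0 = (if n == m then 2 * pi * complex.Re c else 0).
Proof.
move=> f.
have E t : f t =
   complex.Re c * cos ((n%:R - m%:R) * t) - complex.Im c * sin ((n%:R - m%:R) * t).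
  rewrite /f !deMoivre mulrBl cosB sinB !cReM !cImM cReJ cImJ/=; ring.
split.
  rewrite (funext E) => t; apply: differentiable_continuous; apply/derivable1_diffP.
  exact: ex_derive.
have [nm|nm] := eqVneq n m.
  exists (fun t => complex.Re c * t); last by rewrite mulr0 subr0 mulrC.
  move=> t; apply: is_derive_eq.
  by rewrite E nm subrr !mul0r cos0 sin0 mulr0 subr0 /GRing.scale/= !mulr1.
pose d : R := n%:R - m%:R.
have d0 : d != 0 by rewrite subr_eq0 eqr_nat.
exists (fun t => complex.Re c / d * sin (d * t) + complex.Im c / d * cos (d * t)).
  move=> t; apply: is_derive_eq; rewrite E -/d /GRing.scale/=; field.
  exact: d0.
have s2 k : sin (k%:R * (2 * pi)) = 0 :> R /\ cos (k%:R * (2 * pi)) = 1 :> R.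
  have := deMoivre (2 * pi) k; rewrite mulr_natl cos2pi sin2pi.
  rewrite (_ : _ +i* _ = 1)// expr1n => /(congr1 (fun z => (complex.Re z, complex.Im z)))/=.
  by move=> [<- <-].
have [sn cn] := s2 n; have [sm cm] := s2 m.
by rewrite mulr0 sin0 cos0 /d mulrBl sinB cosB sn cn sm cm; ring.
Qed.

(** Parseval's identity on the circle of radius one. *)
Lemma parseval_circle (a : nat -> R[i]) N :
  circle_integral (fun zeta => (modulus (psum a N zeta) ^+ 2)%:E) =
  (\sum_(n < N) modulus (a n) ^+ 2)%:E.
Proof.
pose E t : R[i] := cos t +i* sin t.
pose g (n m : 'I_N) t := complex.Re ((a n * conjc (a m)) * (E t ^+ n * conjc (E t ^+ m))).
have cg n m : continuous (g n m) by have [] := trig_orthogonal (a n * conjc (a m)) n m.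
have /all_sig2[F dF eF] : forall nm : 'I_N * 'I_N, {F : R -> R |
    forall t, is_derive t 1 F (g nm.1 nm.2 t) &
    F (2 * pi) - F 0 = (if nm.1 == nm.2 then 2 * pi * modulus (a nm.1) ^+ 2 else 0)}.
  move=> [n m] /=; apply: cid2.
  have [_ [F dF eF]] := trig_orthogonal (a n * conjc (a m)) n m; exists F => //.
  rewrite eF -[(n == m :> nat)]/(n == m); case: (n =P m) => // ->.
  by rewrite sqr_modulusE.
pose f t := \sum_(n < N) \sum_(m < N) g n m t.
pose Phi := \sum_(n < N) \sum_(m < N) F (n, m).
have fE t : modulus (psum a N (E t)) ^+ 2 = f t.
  rewrite sqr_modulus_sum; apply: eq_bigr => n _; apply: eq_bigr => m _.
  by congr complex.Re; rewrite rmorphM/= mulrACA.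
have twopi : 0 < 2 * pi :> R by rewrite mulr_gt0// pi_gt0.
rewrite /circle_integral.
under eq_integral do rewrite fE.
have dPhi t : 0 <= t <= 2 * pi -> is_derive t 1 Phi (f t).
  move=> _; rewrite (_ : f t = (\sum_(n < N) \sum_(m < N) (fun nm => g nm.1 nm.2 t) (n, m)))//.
  by apply: is_derive_sum => n; apply: is_derive_sum => m; exact: dF (n, m) t.
have cf t : 0 <= t <= 2 * pi -> {for t, continuous f}.
  move=> _; apply: continuous_big_sum => n; apply: continuous_big_sum => m.
  exact: cg.
rewrite (FTC2_is_derive twopi dPhi cf) -EFinM; congr EFin.
have -> : Phi (2 * pi) - Phi 0 = \sum_(n < N) \sum_(m < N) (F (n, m) (2 * pi) - F (n, m) 0).
  rewrite /Phi !fct_sumE -sumrB; apply: eq_bigr => n _.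
  by rewrite !fct_sumE -sumrB.
rewrite (eq_bigr (fun n : 'I_N => 2 * pi * modulus (a n) ^+ 2)).
  by rewrite -mulr_sumr mulrA mulVf ?mul1r// gt_eqF.
move=> n _; rewrite (bigD1 n)//= big1 ?addr0; first by rewrite eF/= eqxx.
by move=> m mn; rewrite eF/= eq_sym (negPf mn).
Qed.

End Expansions.

(** * Taylor expansion of the Bergman projection *)

Section Bergman.
Variable R : realType.
Implicit Types (h k : plane R -> R[i]) (w : plane R) (z : R[i]).

Local Notation D := (disk (1 : R)).

(** Complex area integral over the unit disk. *)
Definition cint h : R[i] := complex_integral D h.

Lemma cintE h : cint h = bint 1 (fun w => complex.Re (h w)) +i*
  bint 1 (fun w => complex.Im (h w)).
Proof. by []. Qed.

Lemma eq_cint h k : (forall w, D w -> h w = k w) -> cint h = cint k.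
Proof. by move=> hk; rewrite !cintE; congr (_ +i* _); apply: eq_bint => w /hk ->. Qed.

Lemma cintD h k : cbm h -> cbm k -> cint (fun w => h w + k w) = cint h + cint k.
Proof.
move=> [h1 h2] [k1 k2]; rewrite !cintE; apply: complexRI; rewrite ?cReD ?cImD/= -bintD//.
  by apply: eq_bint => w _; rewrite cReD.
by apply: eq_bint => w _; rewrite cImD.
Qed.

Lemma cintZ (c : R[i]) h : cbm h -> cint (fun w => c * h w) = c * cint h.
Proof.
move=> [h1 h2]; rewrite !cintE; apply: complexRI; rewrite ?cReM ?cImM/=.
  rewrite -!bintZ// -bintB//; [|exact: bmZ..].
  by apply: eq_bint => w _; rewrite cReM.
rewrite -!bintZ// -bintD//; [|exact: bmZ..].
by apply: eq_bint => w _; rewrite cImM.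
Qed.

Lemma cint_sum I (s : seq I) (F : I -> plane R -> R[i]) :
  (forall i, cbm (F i)) -> cint (fun w => \sum_(i <- s) F i w) = \sum_(i <- s) cint (F i).
Proof.
move=> hF; elim: s => [|i s IH].
  rewrite big_nil cintE; apply: complexRI => /=; rewrite -[RHS](bint0 1);
  by apply: eq_bint => w _; rewrite big_nil.
rewrite big_cons -IH -cintD//; last exact: cbm_sum.
by apply: eq_cint => w _; rewrite big_cons.
Qed.

Lemma modulus_cint_le h (M : R) : 0 <= M -> cbm h ->
  (forall w, D w -> modulus (h w) <= M) -> modulus (cint h) <= M *+ 2.
Proof.
move=> M0 [h1 h2] hM; apply: (le_trans (modulus_le_ReIm _)); rewrite mulr2n cintE /=.
have le01 : 0 <= (1 : R) <= 1 by rewrite ler01 lexx.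
apply: lerD; apply: bint_norm_le => // w /hM; apply: le_trans.
  exact: normr_Re_modulus.
exact: normr_Im_modulus.
Qed.

Lemma bmV (u : plane R -> R) (c : R) : 0 < c -> bm u -> (forall w, D w -> c <= u w) ->
  bm (fun w => (u w)^-1).
Proof.
move=> c0 [mu _] cu; have u0 w : D w -> 0 < u w by move=> /cu; exact: lt_le_trans.
split; last first.
  exists c^-1 => w Dw; rewrite ger0_norm ?invr_ge0 ?(ltW (u0 _ Dw))//.
  by rewrite lef_pV2 ?posrE ?(u0 _ Dw)// cu.
apply: (eq_measurable_fun (fun w => u w `^ (-1))).
  by move=> w /[!inE] Dw; rewrite powR_inv1// ltW// u0.
by apply: (measurableT_comp (f := fun x : R => x `^ (-1))) => //; exact: measurable_powR.
Qed.

Lemma invcE z : z^-1 = (modulus z ^+ 2)^-1%:C * conjc z.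
Proof.
have [->|z0] := eqVneq z 0; first by rewrite invr0 rmorph0 mulr0.
have m0 : modulus z != 0 by apply: contra_neq z0; exact: modulus_eq0.
apply: (mulfI z0); rewrite mulfV// mulrCA.
have -> : z * conjc z = (modulus z ^+ 2)%:C.
  by apply: complexRI; rewrite ?sqr_modulusE// cImM cReJ cImJ/=; ring.
by rewrite -rmorphM/= mulVf ?expf_neq0.
Qed.

Lemma cbmV h (c : R) : 0 < c -> cbm h -> (forall w, D w -> c <= modulus (h w)) ->
  cbm (fun w => (h w)^-1).
Proof.
move=> c0 hh ch; have hi : bm (fun w => (modulus (h w) ^+ 2)^-1).
  apply: (bmV (c := c ^+ 2)); first by rewrite exprn_gt0.
    exact: bm_sqr_modulus.
  by move=> w /ch cw; rewrite ler_pXn2r// nnegrE ?modulus_ge0// ltW.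
apply: (eq_cbm (h := fun w => (modulus (h w) ^+ 2)^-1%:C * conjc (h w))).
  by move=> w _; rewrite -invcE.
by apply: cbmM; [split => //; exact: bm_cst|exact: cbmJ].
Qed.

Lemma disk1_modulus w : D w -> modulus (cplx w) < 1. Proof. by []. Qed.

(** Moments of [mu]; [n.+1 * coef mu n] is the [n]-th Taylor coefficient of its
    Bergman projection. *)
Definition coef (mu : plane R -> R[i]) (n : nat) : R[i] :=
  cint (fun w => mu w * conjc (cplx w ^+ n)).

Lemma cbm_conjX n : cbm (fun w : plane R => conjc (cplx w ^+ n)).
Proof. by apply: cbmJ; apply: cbmX; exact: cbm_cplx. Qed.

(** Taylor expansion of the kernel with its exact remainder. *)
Lemma kernel_expansion (u : R[i]) (N : nat) : 1 - u != 0 ->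
  (1 - u)^-2 = \sum_(n < N) n.+1%:R * u ^+ n +
    u ^+ N * (N.+1%:R - N%:R * u) * (1 - u)^-2.
Proof.
move=> u1; pose r n := u ^+ n * (n.+1%:R - n%:R * u) * (1 - u)^-2.
have step n : r n = n.+1%:R * u ^+ n + r n.+1.
  by rewrite /r -(natr1 n.+1) -(natr1 n) (exprSr u n); field.
rewrite -/(r N); elim: N => [|N IH].
  by rewrite big_ord0 add0r /r expr0 mul1r mul0r subr0 mul1r.
by rewrite big_ord_recr/= -addrA -step.
Qed.

Section OneFunction.
Variable mu : plane R -> R[i].
Hypotheses (hmu : cbm mu) (mu1 : forall w, D w -> modulus (mu w) <= 1).

(** The Taylor coefficients of the Bergman projection of [mu]. *)
Definition bcoef (n : nat) : R[i] := n.+1%:R * coef mu n.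

(** Bound, on the circle of radius [s], for the error of the Taylor polynomial
    with [N] terms. The factor 2 comes from bounding the real and imaginary
    parts of an integral separately. *)
Definition berr (s : R) (N : nat) : R := (s ^+ N * (N.+1 + N)%:R / (1 - s) ^+ 2) *+ 2.

Lemma berr_ge0 s N : 0 <= s -> 0 <= berr s N.
Proof. by move=> s0; rewrite mulrn_wge0// !mulr_ge0 ?exprn_ge0// invr_ge0 sqr_ge0. Qed.

Lemma modulus_1B (s : R) z w : modulus z = s -> D w -> s < 1 ->
  1 - s <= modulus (1 - z * conjc (cplx w)).
Proof.
move=> zs Dw s1; have := modulusD (1 - z * conjc (cplx w)) (z * conjc (cplx w)).
rewrite subrK modulus1 => h; rewrite lerBlDr (le_trans h)// lerD2l.
rewrite modulusM modulusJ zs ler_piMr//; last exact: ltW (disk1_modulus Dw).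
by rewrite -zs modulus_ge0.
Qed.

Lemma bergman_approx (s : R) z (N : nat) : modulus z = s -> s < 1 ->
  modulus (bergman_projection mu z - psum bcoef N z) <= berr s N.
Proof.
move=> zs s1; have s0 : 0 <= s by rewrite -zs modulus_ge0.
have s10 : 0 < 1 - s by rewrite subr_gt0.
pose v w := 1 - z * conjc (cplx w).
have hv : cbm v.
  apply: cbmD (cbm_cst _) _; apply: cbmN; apply: cbmM (cbm_cst _) _; apply: cbmJ.
  exact: cbm_cplx.
have vs w : D w -> 1 - s <= modulus (v w) by move=> Dw; exact: modulus_1B.
have v0 w : D w -> v w != 0.
  move=> /vs h; apply: contraTneq h => ->.
  by rewrite modulus0 -ltNge.
have hu : cbm (fun w => z * conjc (cplx w)).
  by apply: cbmM (cbm_cst _) _; apply: cbmJ; exact: cbm_cplx.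
pose Q w := N.+1%:R - N%:R * (z * conjc (cplx w)).
pose rem w := mu w * ((z * conjc (cplx w)) ^+ N * Q w * (v w)^-1 ^+ 2).
have hrem : cbm rem.
  apply: cbmM hmu _; apply: cbmM; [apply: cbmM|].
  - exact: cbmX.
  - by apply: cbmD (cbm_cst _) _; apply: cbmN; apply: cbmM (cbm_cst _) _.
  - by apply: cbmX; exact: (cbmV s10 hv vs).
pose main (n : 'I_N) w := n.+1%:R * z ^+ n * (mu w * conjc (cplx w ^+ n)).
have hmain n : cbm (main n).
  by apply: cbmM (cbm_cst _) _; apply: cbmM hmu _; exact: cbm_conjX.
have -> : bergman_projection mu z = psum bcoef N z + cint rem.
  rewrite -[bergman_projection mu z]/(cint (fun w => mu w / (1 - z * conjc (cplx w)) ^+ 2)).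
  rewrite (eq_cint (k := fun w => \sum_(n < N) main n w + rem w)).
    rewrite cintD//; last exact: cbm_sum.
    rewrite cint_sum//; congr (_ + _); apply: eq_bigr => n _.
    rewrite cintZ; first by rewrite -/(coef mu n) /bcoef mulrAC.
    by apply: cbmM hmu _; exact: cbm_conjX.
  move=> w Dw; rewrite (kernel_expansion N (v0 _ Dw)) mulrDr /rem exprVn; congr (_ + _).
  rewrite mulr_sumr; apply: eq_bigr => n _.
  by rewrite /main exprMn rmorphXn/=; ring.
rewrite addrAC subrr add0r; apply: modulus_cint_le => //.
  by rewrite !mulr_ge0 ?exprn_ge0// invr_ge0 sqr_ge0.
move=> w Dw; rewrite /rem !modulusM -[leRHS]mul1r; apply: ler_pM.
- exact: modulus_ge0.
- by rewrite !mulr_ge0 ?modulus_ge0.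
- exact: mu1.
have w1 := ltW (disk1_modulus Dw).
apply: ler_pM; rewrite ?mulr_ge0 ?modulus_ge0//; first apply: ler_pM; rewrite ?modulus_ge0//.
- rewrite modulusX modulusM modulusJ zs; apply: lerXn2r.
  + by rewrite nnegrE mulr_ge0// modulus_ge0.
  + by rewrite nnegrE.
  + by rewrite ler_piMr.
- rewrite natrD (le_trans (modulusD _ _))// modulusN modulusM modulusM modulusJ zs.
  have mn n : modulus (n%:R : R[i]) = n%:R.
    by rewrite -(rmorph_nat (real_complex R)) modulus_real ger0_norm.
  by rewrite !mn lerD2l ler_piMr// mulr_ile1 ?modulus_ge0// ltW.
- rewrite -expr2 modulusV -exprVn; apply: lerXn2r.
  + by rewrite nnegrE invr_ge0 modulus_ge0.
  + by rewrite nnegrE invr_ge0 ltW.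
  + by rewrite lef_pV2 ?vs// posrE// (lt_le_trans s10)// vs.
Qed.

Lemma modulus_bergman_le (s : R) z : modulus z = s -> s < 1 ->
  modulus (bergman_projection mu z) <= berr s 0.
Proof.
move=> zs s1; have := bergman_approx 0 zs s1.
by rewrite /psum big_ord0 subr0.
Qed.

Lemma natmul_expr_le (s : R) (n : nat) : 0 <= s < 1 -> n%:R * s ^+ n <= (1 - s)^-1.
Proof.
move=> /andP[s0 s1]; have d : 0 < 1 - s by rewrite subr_gt0.
have h : (1 - s) * (\sum_(i < n) s ^+ i) = 1 - s ^+ n.
  elim: n => [|n IH]; first by rewrite big_ord0 mulr0 expr0 subrr.
  by rewrite big_ord_recr/= mulrDr IH exprS; ring.
rewrite -[leRHS]mul1r ler_pdivlMr// mulrC.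
apply: (@le_trans _ _ ((1 - s) * (\sum_(i < n) s ^+ i))).
  rewrite ler_pM2l// mulr_natl.
  have -> : s ^+ n *+ n = \sum_(i < n) s ^+ n by rewrite sumr_const card_ord.
  by apply: ler_sum => i _; apply: ler_wiXn2l; [exact: s0|exact: ltW|exact/ltnW/ltn_ord].
by rewrite h lerBlDr lerDl exprn_ge0.
Qed.

Lemma berr_cvg0 (s : R) : 0 <= s < 1 -> berr s N @[N --> \oo] --> (0 : R).
Proof.
move=> /andP[s0 s1]; have d : 0 < 1 - s by rewrite subr_gt0.
(* one factor [q ^+ N] absorbs the growth of [N], the other tends to zero *)
pose q := Num.sqrt s; have q0 : 0 <= q := sqrtr_ge0 s.
have qq : q ^+ 2 = s by rewrite sqr_sqrtr.
have q1 : q < 1 by rewrite -(expr_lt1 (n := 2))// qq.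
pose K := ((2 / (1 - q) + 1) / (1 - s) ^+ 2) *+ 2.
have bnd n : berr s n <= q ^+ n * K.
  have g := natmul_expr_le n (introT andP (conj q0 q1)).
  have qn1 : q ^+ n <= 1 by rewrite exprn_ile1// ltW.
  have h : s ^+ n * (n.+1 + n)%:R <= q ^+ n * (2 / (1 - q) + 1).
    rewrite -qq exprAC expr2 -mulrA ler_wpM2l ?exprn_ge0//.
    rewrite -addn1 !natrD; have := g; have := qn1; set x := q ^+ n; set y := n%:R.
    move=> x1 yx; have -> : x * (y + 1 + y) = 2 * (y * x) + x by ring.
    by apply: lerD => //; rewrite ler_pM2l.
  by rewrite /berr /K [leRHS]mulrnAr lerMn2r/= mulrA ler_pM2r ?invr_gt0 ?exprn_gt0.
apply: (@squeeze_cvgr _ _ _ _ (fun=> 0) (fun n => q ^+ n * K)).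
- by apply: nearW => n; rewrite berr_ge0//= bnd.
- exact: cvg_cst.
- rewrite -[X in _ --> X](mul0r K); apply: cvgM; last exact: cvg_cst.
  by apply: cvg_expr; rewrite ger0_norm.
Qed.

End OneFunction.
End Bergman.

(** * Circle means and discrepancies *)

Section CircleMean.
Variable R : realType.
Implicit Types (w : plane R) (z : R[i]).

Local Notation D := (disk (1 : R)).

Lemma continuous_psum_circle (a : nat -> R[i]) (N : nat) :
  continuous (fun t => modulus (psum a N (cos t +i* sin t)) ^+ 2).
Proof.
pose f (n m : 'I_N) t := complex.Re ((a n * conjc (a m)) *
  ((cos t +i* sin t) ^+ n * conjc ((cos t +i* sin t) ^+ m))).
rewrite (_ : (fun _ => _) = (fun t => \sum_(n < N) \sum_(m < N) f n m t)).
  apply: continuous_big_sum => n; apply: continuous_big_sum => m.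
  by have [] := trig_orthogonal (a n * conjc (a m)) n m.
apply/funext => t; rewrite sqr_modulus_sum; apply: eq_bigr => n _; apply: eq_bigr => m _.
by congr complex.Re; rewrite rmorphM/= mulrACA.
Qed.

(** Comparison of circle means up to an additive constant. *)
Lemma circle_integral_le (u v : R[i] -> R) (e : R) :
  let cis (t : R) := cos t +i* sin t in
  measurable_fun (`[0%R, (2 * pi)%R]%classic : set R) (u \o cis) ->
  measurable_fun (`[0%R, (2 * pi)%R]%classic : set R) (v \o cis) ->
  0 <= e -> (forall z, 0 <= u z) -> (forall z, 0 <= v z) ->
  (forall t, u (cis t) <= v (cis t) + e) ->
  (circle_integral (fun z => (u z)%:E) <= circle_integral (fun z => (v z)%:E) + e%:E)%E.
Proof.
move=> cis mu mv e0 u0 v0 uv.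
have p0 : 0 < 2 * pi :> R by rewrite mulr_gt0// pi_gt0.
have i0 : (0 <= ((2 * pi)^-1 : R)%:E)%E by rewrite lee_fin invr_ge0 ltW.
have -> : e%:E = (((2 * pi)^-1 : R)%:E * \int[@lebesgue_measure R]_(t in `[0%R, (2 * pi)%R]) e%:E)%E.
  have -> : (\int[@lebesgue_measure R]_(t in `[0%R, (2 * pi)%R]) e%:E = e%:E * (2 * pi)%:E)%E.
    apply: (etrans (integral_cst _ _ _)) => //; congr (_ * _)%E.
    by apply: (etrans (lebesgue_measure_itv _)); rewrite /= lte_fin p0 oppr0 adde0.
  by rewrite -!EFinM; congr EFin; rewrite mulrCA mulVf ?mulr1// gt_eqF.
rewrite /circle_integral -ge0_muleDr; last 2 first.
- by apply: integral_ge0 => t _; rewrite lee_fin.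
- by apply: integral_ge0 => t _; rewrite lee_fin.
have mvE : measurable_fun (`[0%R, (2 * pi)%R]%classic : set R) (EFin \o (v \o cis)).
  exact/measurable_EFinP.
have v0' t : `[0%R, (2 * pi)%R]%classic t -> (0 <= (v (cis t))%:E)%E by rewrite lee_fin.
have e0' (t : R) : `[0%R, (2 * pi)%R]%classic t -> (0 <= e%:E)%E by rewrite lee_fin.
apply: lee_wpmul2l => //.
have addE := ge0_integralD (@lebesgue_measure R) (measurable_itv _) v0' mvE e0' (measurable_cst _).
apply: (@le_trans _ _ _ _ _ _ (eq_ind _ (fun y => (_ <= y)%E) (lexx _) _ addE)).
apply: ge0_le_integral => //.
- by move=> t _; rewrite lee_fin.
- exact/measurable_EFinP.
- apply: (eq_measurable_fun (EFin \o (fun t => v (cis t) + e))) => [t _|].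
    by rewrite /= EFinD.
  apply/measurable_EFinP; exact: (measurable_funD mv (measurable_cst e)).
- by move=> t _; rewrite -EFinD lee_fin; exact: uv.
Qed.

Section OneFunction.
Variables (mu : plane R -> R[i]) (r : R).
Hypotheses (hmu : cbm mu) (mu1 : forall w, D w -> modulus (mu w) <= 1) (r01 : 0 < r < 1).

(** Energy of the Taylor coefficients, below degree [N], of the dilate by [r] of
    the Bergman projection of [mu]. *)
Definition energy (N : nat) : R :=
  \sum_(n < N) modulus (bcoef mu n * r%:C ^+ n) ^+ 2.

Lemma energy_le (N M : nat) : (N <= M)%N -> energy N <= energy M.
Proof.
move=> NM; rewrite /energy -!(big_mkord xpredT (fun n => modulus (bcoef mu n * r%:C ^+ n) ^+ 2)).
rewrite [leRHS](big_cat_nat (leq0n N) NM)/= lerDl; apply: sumr_ge0 => n _; exact: sqr_ge0.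
Qed.

Lemma psum_dilate (a : nat -> R[i]) (t : R) N z :
  psum a N (t%:C * z) = psum (fun n => a n * t%:C ^+ n) N z.
Proof. by apply: eq_bigr => n _; rewrite exprMn mulrA. Qed.

Let mean := circle_integral (fun zeta =>
  (modulus (dilate (bergman_projection mu) r zeta) ^+ 2)%:E).

(** The quadratic mean over the circle of radius [r] is the limit, hence the
    supremum, of the energies. *)
Lemma circle_mean_energy : exists c : R,
  [/\ mean = c%:E, forall N, energy N <= c & forall y, (forall N, energy N <= y) -> c <= y].
Proof.
have /andP[r0 r1] := r01.
pose b n := bcoef mu n * r%:C ^+ n.
pose cis (t : R) := cos t +i* sin t.
pose g z := modulus (dilate (bergman_projection mu) r z) ^+ 2.
pose p N z := modulus (psum b N z) ^+ 2.
pose err N := berr r N * (berr r 0 *+ 2 + berr r N).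
have b0 N : 0 <= berr r N by exact: berr_ge0 (ltW r0).
have err0 N : 0 <= err N by rewrite mulr_ge0// addr_ge0// mulrn_wge0.
have errE N t : `|p N (cis t) - g (cis t)| <= err N.
  have zr : modulus (r%:C * cis t) = r.
    by rewrite modulusM modulus_cis mulr1 modulus_real gtr0_norm.
  have h := bergman_approx hmu mu1 N zr r1; have h0 := modulus_bergman_le hmu mu1 zr r1.
  move: h; rewrite psum_dilate -/b; rewrite /p /g /dilate.
  set x := bergman_projection _ _ in h0 *; set y := psum _ _ _ => h.
  have yx : modulus y <= modulus x + berr r N.
    have := modulusD x (- (x - y)); rewrite modulusN opprB addrC subrK => /le_trans; apply.
    by rewrite lerD2l.
  have xy : modulus x <= modulus y + berr r N.
    by have := modulusD (x - y) y; rewrite subrK addrC => /le_trans; apply; rewrite lerD2l.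
  have d : `|modulus y - modulus x| <= berr r N by rewrite ler_norml; apply/andP; split; lra.
  rewrite subr_sqr normrM; apply: ler_pM => //.
  rewrite ger0_norm ?addr_ge0 ?modulus_ge0// mulr2n; lra.
have ecv : err N @[N --> \oo] --> (0 : R).
  rewrite -(mul0r (berr r 0 *+ 2 + 0)); apply: cvgM.
    by apply: berr_cvg0; rewrite ltW.
  by apply: cvgD; [exact: cvg_cst|apply: berr_cvg0; rewrite ltW].
have mp N : measurable_fun (`[0%R, (2 * pi)%R]%classic : set R) (p N \o cis).
  by apply: measurable_funTS; apply: continuous_measurable_fun; exact: continuous_psum_circle.
have mg : measurable_fun (`[0%R, (2 * pi)%R]%classic : set R) (g \o cis).
  apply: (measurable_fun_cvg (h := fun N => p N \o cis)) => // t _.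
  apply/cvgrPdist_le => e e0; move/cvgrPdist_le : ecv => /(_ e e0).
  apply: filterS => N; rewrite sub0r normrN ger0_norm// => Ne /=.
  by rewrite distrC (le_trans (errE N t)).
have g0 z : 0 <= g z by exact: sqr_ge0.
have p0 N z : 0 <= p N z by exact: sqr_ge0.
have pE N : circle_integral (fun z => (p N z)%:E) = (energy N)%:E by exact: parseval_circle.
have up N : (mean <= (energy N + err N)%:E)%E.
  rewrite EFinD -pE; apply: (circle_integral_le (u := g) (v := p N)) => // t.
  by have := errE N t; rewrite ler_norml => /andP[+ _]; rewrite /cis; lra.
have dn N : ((energy N)%:E <= mean + (err N)%:E)%E.
  rewrite -pE; apply: (circle_integral_le (u := p N) (v := g)) => // t.
  by have := errE N t; rewrite ler_norml => /andP[_]; rewrite /cis; lra.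
have fm : mean \is a fin_num.
  rewrite ge0_fin_numE; first exact: (le_lt_trans (up 0%N) (ltry _)).
  apply: mule_ge0; first by rewrite lee_fin invr_ge0 mulr_ge0 ?pi_ge0.
  by apply: integral_ge0 => t _; rewrite lee_fin sqr_ge0.
exists (fine mean); rewrite fineK//; split=> // [N|y hy].
- have : \forall M \near \oo, energy N - err M <= fine mean.
    exists N => // M /= NM; rewrite lerBlDr (le_trans (energy_le NM))//.
    by rewrite -lee_fin EFinD fineK.
  have : (energy N - err M) @[M --> \oo] --> energy N.
    by rewrite -[X in _ --> X]subr0; apply: cvgB => //; exact: cvg_cst.
  by move=> c n; exact: (cvgr_to_le c n).
- have : \forall M \near \oo, fine mean <= y + err M.
    apply: nearW => M; rewrite -lee_fin fineK// (le_trans (up M))// lee_fin.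
    by rewrite lerD2r.
  have : (y + err M) @[M --> \oo] --> y.
    by rewrite -[X in _ --> X]addr0; apply: cvgD => //; exact: cvg_cst.
  by move=> c n; exact: (cvgr_to_ge c n).
Qed.

Lemma Re_cint h : complex.Re (cint h) = bint 1 (fun w => complex.Re (h w)).
Proof. by []. Qed.

(** Pairing with a polynomial, in terms of the moments. *)
Lemma pairing (a : nat -> R[i]) (N : nat) :
  bint 1 (fun w => complex.Re (mu w * conjc (psum a N (cplx w)))) =
  \sum_(n < N) complex.Re (coef mu n * conjc (a n)).
Proof.
rewrite -Re_cint -cRe_sum; congr complex.Re.
rewrite (eq_cint (k := fun w => \sum_(n < N) conjc (a n) * (mu w * conjc (cplx w ^+ n)))).
  rewrite cint_sum => [|n]; last first.
    by apply: cbmM (cbm_cst _) _; apply: cbmM hmu _; exact: cbm_conjX.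
  apply: eq_bigr => n _; rewrite cintZ; first by rewrite mulrC.
  by apply: cbmM hmu _; exact: cbm_conjX.
move=> w _; rewrite rmorph_sum/= mulr_sumr; apply: eq_bigr => n _.
by rewrite rmorphM/= mulrCA.
Qed.

End OneFunction.

Section Discrepancy.
Variable r : R.
Hypothesis r01 : 0 < r < 1.

Lemma log_weight_gt0 : 0 < log_weight r.
Proof.
have /andP[r0 r1] := r01; rewrite /log_weight div1r ln_gt0// invf_gt1.
  by rewrite gtrBl exprn_gt0.
by rewrite subr_gt0 expr_lt1// ltW.
Qed.

Lemma sub1_sqmod_gt0 w : D w -> 0 < 1 - sqmod w.
Proof. by move=> /disk1_sqmod; rewrite subr_gt0. Qed.

Lemma disk_sqmod w : disk r w -> sqmod w < r ^+ 2.
Proof. by have /andP[r0 r1] := r01; rewrite diskE ?ltW//= in_itv/= => /andP[]. Qed.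

Lemma bm_1Bsqmod : bm (fun w => 1 - sqmod w : R).
Proof. by apply: bmB (bm_cst _) _; exact: bm_sqmod. Qed.

(** The indicator keeps the weight [1 / (1 - |w|^2)] bounded. *)
Lemma bm_weight : bm (fun w => \1_(disk r) w * (1 - sqmod w)^-1).
Proof.
have /andP[r0 r1] := r01; have r21 : 0 < 1 - r ^+ 2 by rewrite subr_gt0 expr_lt1// ltW.
split.
  apply: measurable_funM; first by apply: measurable_indic; exact: measurable_disk.
  apply: (eq_measurable_fun (fun w => (1 - sqmod w) `^ (-1))).
    by move=> w /[!inE] Dw; rewrite powR_inv1// ltW// sub1_sqmod_gt0.
  apply: (measurableT_comp (f := fun x : R => x `^ (-1))); first exact: measurable_powR.
  by case: bm_1Bsqmod.
exists (1 - r ^+ 2)^-1 => w Dw; rewrite indicE; case: (boolP (w \in disk r)) => [|_].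
  rewrite inE mul1r => /disk_sqmod wr; have w1 := sub1_sqmod_gt0 Dw.
  by rewrite ger0_norm ?invr_ge0 ?(ltW w1)// lef_pV2 ?posrE// lerD2l lerN2 ltW.
by rewrite mul0r normr0 invr_ge0 ltW.
Qed.

Lemma bint_weight : bint r (fun w => \1_(disk r) w * (1 - sqmod w)^-1) = log_weight r.
Proof.
rewrite (eq_bint (v := fun w => (1 - sqmod w)^-1)).
  by rewrite /bint /Rintegral integral_disk_weight.
by move=> w dw; rewrite indicE mem_set// mul1r.
Qed.

(** Expansion of the square in the discrepancy. *)
Lemma discrepancyE (f : {poly R[i]}) (a : nat -> R[i]) (N : nat) :
  (forall z, f.[z] = psum a N z) ->
  discrepancy r f = ((log_weight r - 2 * bint r (fun w => modulus (psum a N (cplx w))) +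
    bint r (fun w => (1 - sqmod w) * modulus (psum a N (cplx w)) ^+ 2)) / log_weight r)%:E.
Proof.
have /andP[r0 r1] := r01; move=> fE.
have h1 := bm_modulus (cbm_psum a N); have h2 := bm_sqr_modulus (cbm_psum a N).
pose u w := \1_(disk r) w * (1 - sqmod w)^-1 - 2 * modulus (psum a N (cplx w)) +
  (1 - sqmod w) * modulus (psum a N (cplx w)) ^+ 2.
have hu1 : bm (fun w => 2 * modulus (psum a N (cplx w))) by exact: bmZ.
have hu2 : bm (fun w => (1 - sqmod w) * modulus (psum a N (cplx w)) ^+ 2).
  by apply: bmM => //; exact: bm_1Bsqmod.
have hu3 := bmB bm_weight hu1.
rewrite /discrepancy (eq_integral (EFin \o u)); last first.
  move=> w /[!inE] dw; congr EFin; rewrite fE /u indicE mem_set// mul1r sqmod_modulus.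
  have := sub1_sqmod_gt0 (subset_disk (ltW r1) dw) => h; field; rewrite gt_eqF//.
rewrite [X in (_ * X)%E](bint_EFin (ltW r1) (bmD hu3 hu2)).
rewrite -EFinM mulrC; congr (EFin (_ / _)).
have r1' := ltW r1.
by rewrite (bintD r1' hu3 hu2) (bintB r1' bm_weight hu1) (bintZ 2 r1' h1) bint_weight.
Qed.

End Discrepancy.

(** The bound from above: the Taylor coefficients of the Bergman projection,
    suitably weighted, give a polynomial of small discrepancy. *)
Lemma energy_discrepancy (mu : plane R -> R[i]) (r : R) (N : nat) :
  cbm mu -> (forall w, D w -> modulus (mu w) <= 1) -> 0 < r < 1 ->
  exists f : {poly R[i]},
    (discrepancy r f <= (1 - (2 * r ^+ 2 - 1) * energy mu r N / log_weight r)%:E)%E.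
Proof.
move=> hmu mu1 r01; have /andP[r0 r1] := r01.
pose a n := n.+1%:R ^+ 2 * r%:C ^+ n * coef mu n.
exists (\poly_(n < N) a n).
rewrite (discrepancyE r01 (a := a) (N := N)); last by move=> z; rewrite horner_poly.
have L0 := log_weight_gt0 r01.
rewrite lee_fin ler_pdivrMr// mulrBl mul1r divfK ?gt_eqF//.
have mn n : modulus (n%:R : R[i]) = n%:R.
  by rewrite -(rmorph_nat (real_complex R)) modulus_real ger0_norm.
have mr : modulus r%:C = r by rewrite modulus_real gtr0_norm.
have X1 : energy mu r N <= bint 1 (fun w => modulus (psum (fun n => a n * r%:C ^+ n) N (cplx w))).
  have -> : energy mu r N = bint 1 (fun w => complex.Re (mu w *
      conjc (psum (fun n => a n * r%:C ^+ n) N (cplx w)))).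
    rewrite pairing//; apply: eq_bigr => n _.
    rewrite /a /bcoef sqr_modulusE; congr complex.Re.
    have := conjc_real r; move: (coef mu n) (r%:C) => c x cx.
    by rewrite !rmorphM !rmorphXn/= !rmorph_nat cx; ring.
  have hp := cbm_psum (fun n => a n * r%:C ^+ n) N.
  apply: le_bint => //; first by case: (cbmM hmu (cbmJ hp)).
    exact: bm_modulus.
  move=> w Dw; apply: (le_trans (Re_le_modulus _)); rewrite modulusM modulusJ.
  by rewrite ler_piMl ?modulus_ge0// mu1.
have J1 : bint r (fun w => modulus (psum a N (cplx w))) =
    r ^+ 2 * bint 1 (fun w => modulus (psum (fun n => a n * r%:C ^+ n) N (cplx w))).
  have r0l : 0 < r <= 1 by rewrite r0 ltW.
  have H := bint_dilate r0l (lexx 1) (bm_modulus (cbm_psum a N)) (fun w _ => modulus_ge0 _).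
  rewrite (mulr1 r) in H.
  apply: (etrans H).
  apply: congr1.
  apply: eq_bint => w _.
  rewrite cplx_dilate.
  rewrite psum_dilate.
  by [].
have I1 : bint r (fun w => (1 - sqmod w) * modulus (psum a N (cplx w)) ^+ 2) <= energy mu r N.
  have h2 : bm (fun w => (1 - sqmod w) * modulus (psum a N (cplx w)) ^+ 2).
    by apply: bmM; [exact: bm_1Bsqmod|exact: bm_sqr_modulus (cbm_psum _ _)].
  apply: (@le_trans _ _ (bint 1 (fun w => (1 - sqmod w) * modulus (psum a N (cplx w)) ^+ 2))).
    rewrite -(bint_indic _ (ltW r1)); apply: le_bint => //.
      by apply: bmM => //; apply: bm_indic; exact: measurable_disk.
    move=> w Dw; apply: ler_piMl; last by rewrite indicE; case: (_ \in _).
    by rewrite mulr_ge0 ?sqr_ge0// ltW// sub1_sqmod_gt0.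
  rewrite parseval_disk; apply: ler_sum => n _.
  rewrite ler_pdivrMr ?mulr_gt0// /a /bcoef !modulusM !modulusX !mn mr.
  set c := modulus (coef mu n); set x := r ^+ n; set k : R := n.+1%:R.
  rewrite -[n.+2%:R]natr1 -/k.
  have -> : (k ^+ 2 * x * c) ^+ 2 = (k * c * x) ^+ 2 * (k * k) by ring.
  rewrite ler_wpM2l ?sqr_ge0// ler_wpM2l// lerDl//.
rewrite J1; set X := energy mu r N in X1 I1 *; set J := bint 1 _ in X1 *.
set I := bint r _ in I1 *.
have rX : r ^+ 2 * X <= r ^+ 2 * J by rewrite ler_wpM2l// sqr_ge0.
lra.
Qed.

End CircleMean.

(** * Lower bound for the energy *)

Section Sign.
Variable R : realType.
Implicit Types (w : plane R) (z : R[i]) (h : plane R -> R[i]).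

(** The unimodular part of a complex number, with value 1 at 0 so that it has
    modulus one everywhere. *)
Definition csign z : R[i] := if z == 0 then 1 else (modulus z)^-1%:C * z.

Lemma modulus_csign z : modulus (csign z) = 1.
Proof.
rewrite /csign; case: ifPn => [_|z0]; first by rewrite modulus1.
have m0 : modulus z != 0 by apply: contra_neq z0; exact: modulus_eq0.
by rewrite modulusM modulus_real ger0_norm ?invr_ge0 ?modulus_ge0// mulVf.
Qed.

Lemma csign_conj z : complex.Re (csign z * conjc z) = modulus z.
Proof.
rewrite /csign; case: eqP => [->|/eqP z0]; first by rewrite rmorph0 mulr0 modulus0.
have m0 : modulus z != 0 by apply: contra_neq z0; exact: modulus_eq0.
by rewrite -mulrA cReZ -sqr_modulusE expr2 mulrA mulVf ?mul1r.
Qed.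

Lemma measT_csign h : measT h -> measT (fun w => csign (h w)).
Proof.
move=> mh; pose Z := [set w | modulus (h w) = 0].
have mm := measT_modulus mh.
have mZ : measurable Z.
  by have := mm measurableT _ (measurable_set1 0); rewrite setTI.
have mi : measurable_fun [set: plane R] (\1_Z : plane R -> R) by exact: measurable_indic.
pose u w : R := (modulus (h w) + \1_Z w) `^ (-1).
have mu : measurable_fun [set: plane R] u.
  apply: (measurableT_comp (f := fun x : R => x `^ (-1))); first exact: measurable_powR.
  exact: measurable_funD.
have E w : csign (h w) = (u w)%:C * h w + (\1_Z w)%:C.
  have p0 : 0 <= modulus (h w) + \1_Z w by rewrite addr_ge0 ?modulus_ge0// indicE ler0n.
  rewrite /u powR_inv1// /csign indicE; case: eqP => [h0|/eqP h0].
    by rewrite mem_set ?h0 ?mulr0 ?add0r// /Z/= h0 modulus0.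
  rewrite memNset ?addr0// /Z/= => /modulus_eq0 e; by rewrite e eqxx in h0.
case: mh => m1 m2; split.
  rewrite (_ : (fun _ => _) = (fun w => u w * complex.Re (h w) + \1_Z w)).
    by apply: measurable_funD => //; exact: measurable_funM.
  by apply/funext => w; rewrite E cReD cReZ.
rewrite (_ : (fun _ => _) = (fun w => u w * complex.Im (h w))).
  exact: measurable_funM.
by apply/funext => w; rewrite E cImD cImZ/= addr0.
Qed.

Lemma measT_psum (a : nat -> R[i]) N : measT (fun w => psum a N (cplx w)).
Proof.
apply: measT_sum => n; apply: measTM; [exact: measT_cst|].
by apply: measTX; exact: measT_cplx.
Qed.

End Sign.

Section LowerBound.
Variable R : realType.
Implicit Types (w : plane R) (z : R[i]).

Local Notation D := (disk (1 : R)).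

Lemma amgm_weight (d x s : R) : 0 < d -> 0 < s -> 2 * x <= d * (s * x ^+ 2) + d^-1 * s^-1.
Proof.
move=> d0 s0; have ds : 0 < d * s by rewrite mulr_gt0.
have : 0 <= (d * s * x - 1) ^+ 2 / (d * s) by rewrite divr_ge0 ?sqr_ge0// ltW.
have -> : (d * s * x - 1) ^+ 2 / (d * s) = d * (s * x ^+ 2) + d^-1 * s^-1 - 2 * x.
  by field; rewrite !gt_eqF.
by rewrite subr_ge0.
Qed.

Variables (r : R) (a : nat -> R[i]) (N : nat).
Hypothesis r01 : 0 < r < 1.

Let r0 : 0 < r. Proof. by case/andP: r01. Qed.
Let r1 : r < 1. Proof. by case/andP: r01. Qed.
Let r1' : r <= 1. Proof. exact: ltW. Qed.

(* [J] and [I] enter the discrepancy of [f] through [discrepancyE] *)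
Local Notation f := (psum a N).
Local Notation J := (bint r (fun w => modulus (f (cplx w)))).
Local Notation I := (bint r (fun w => (1 - sqmod w) * modulus (f (cplx w)) ^+ 2)).

Let hf : bm (fun w => modulus (f (cplx w))).
Proof. exact: bm_modulus (cbm_psum _ _). Qed.

Let hf2 : bm (fun w => (1 - sqmod w) * modulus (f (cplx w)) ^+ 2).
Proof. by apply: bmM; [exact: bm_1Bsqmod|exact: bmX]. Qed.

Let in_disk1 w : disk r w -> D w. Proof. exact: subset_disk. Qed.

(** A polynomial which beats the zero polynomial has controlled norm. *)
Lemma energy_bound_log : 0 < 2 * J - I -> I <= 4 * log_weight r.
Proof.
move=> JI; suff : 2 * J <= 2^-1 * I + 2 * log_weight r by lra.
rewrite -(bint_weight r01) -!bintZ//; last exact: bm_weight.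
rewrite -bintD//; [|exact: bmZ|apply: bmZ; exact: bm_weight].
apply: le_bint => //; [exact: bmZ|apply: bmD; apply: bmZ => //; exact: bm_weight|].
move=> w dw; have w1 := sub1_sqmod_gt0 (in_disk1 dw).
have h2 : (0 : R) < 2^-1 by rewrite invr_gt0.
have := amgm_weight (modulus (f (cplx w))) h2 w1.
by rewrite invrK indicE mem_set// mul1r.
Qed.

(** Squared norm of the dilate of [f] by [r] in the weighted space on the unit disk. *)
Let W := \sum_(n < N) modulus (a n) ^+ 2 * r ^+ n ^+ 2 / (n.+1%:R * n.+2%:R).

Let W_le : r ^+ 2 * W <= I.
Proof.
have -> : W = bint 1 (fun w => (1 - sqmod w) *
    modulus (psum (fun n => a n * r%:C ^+ n) N (cplx w)) ^+ 2).
  rewrite parseval_disk; apply: eq_bigr => n _; congr (_ / _).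
  by rewrite modulusM modulusX modulus_real gtr0_norm// exprMn.
have r0l : 0 < r <= 1 by rewrite r0.
have H := bint_dilate r0l (lexx 1) hf2.
rewrite (mulr1 r) in H; rewrite H; last first.
  by move=> w Dw; rewrite mulr_ge0 ?sqr_ge0// ltW// sub1_sqmod_gt0.
apply: ler_wpM2l; first exact: sqr_ge0.
apply: (le_bint (lexx 1)).
- by apply: bmM; [exact: bm_1Bsqmod|apply: bm_sqr_modulus; exact: cbm_psum].
- apply: (eq_bm (u := fun w => (1 - r ^+ 2 * sqmod w) *
    modulus (psum (fun n => a n * r%:C ^+ n) N (cplx w)) ^+ 2)).
    by move=> w _; rewrite sqmod_dilate cplx_dilate psum_dilate.
  apply: bmM; first by apply: bmB (bm_cst _) _; apply: bmZ; exact: bm_sqmod.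
  by apply: bm_sqr_modulus; exact: cbm_psum.
move=> w Dw; rewrite sqmod_dilate cplx_dilate psum_dilate.
rewrite ler_wpM2r ?sqr_ge0// lerD2l lerN2 ler_piMl ?sqmod_ge0//.
by rewrite expr_le1// ltW.
Qed.

(** Coefficients of the polynomial [z * f (r^2 z)]. The dilation makes up for
    the factors [r ^- (2 * n)] in [energy_ge_pairing]. The factor [z] raises the
    degrees, so that [1 / (n + 2)^2], which is at most [1 / ((n + 1) (n + 2))],
    stands against the [n]-th coefficient of [f]. *)
Definition shifted (n : nat) : R[i] :=
  if n is m.+1 then a m * (r ^+ 2)%:C ^+ m else 0.

Lemma psum_shifted z : psum shifted N.+1 z = z * f ((r ^+ 2)%:C * z).
Proof.
rewrite /psum big_ord_recl mul0r add0r mulr_sumr; apply: eq_bigr => n _.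
rewrite lift0 /shifted (exprMn n) (exprS z n).
by move: ((r ^+ 2)%:C) => x; ring.
Qed.

Local Notation p := (psum shifted N.+1).

Let hp : bm (fun w => modulus (p (cplx w))).
Proof. exact: bm_modulus (cbm_psum _ _). Qed.

Let hp2 : bm (fun w => (1 - sqmod w) * modulus (p (cplx w)) ^+ 2).
Proof. by apply: bmM; [exact: bm_1Bsqmod|exact: bmX]. Qed.

Let modulus_shifted n : modulus (shifted n.+1) ^+ 2 = modulus (a n) ^+ 2 * (r ^+ n ^+ 2) ^+ 2.
Proof.
rewrite /shifted modulusM modulusX modulus_real ger0_norm ?sqr_ge0// exprMn.
by rewrite exprAC.
Qed.

Lemma shifted_norm_le :
  bint 1 (fun w => (1 - sqmod w) * modulus (p (cplx w)) ^+ 2) <= r ^- 2 * I.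
Proof.
rewrite parseval_disk big_ord_recl modulus0 expr0n mul0r add0r.
apply: (@le_trans _ _ W); last by rewrite ler_pdivlMl ?exprn_gt0.
apply: ler_sum => n _; rewrite lift0 modulus_shifted -[leLHS]mulrA -[leRHS]mulrA; apply: ler_pM.
- exact: sqr_ge0.
- by rewrite mulr_ge0 ?sqr_ge0// invr_ge0 mulr_ge0.
- by [].
apply: ler_pM; rewrite ?sqr_ge0 ?invr_ge0 ?mulr_ge0//.
- have y1 : r ^+ n ^+ 2 <= 1 by rewrite -exprM exprn_ile1// ltW.
  by rewrite [leLHS]expr2 ler_piMr// sqr_ge0.
- by rewrite lef_pV2 ?posrE ?mulr_gt0// ler_pM// ler_nat.
Qed.

(** Termwise, [2 Re (x conj y) <= |x|^2 + |y|^2], where [x] is a Taylor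
    coefficient of the Bergman projection. *)
Lemma energy_ge_pairing (mu : plane R -> R[i]) : cbm mu ->
  2 * bint 1 (fun w => complex.Re (mu w * conjc (p (cplx w)))) - r ^- 4 * I <=
  energy mu r N.+1.
Proof.
move=> hmu.
pose E := \sum_(n < N) modulus (a n) ^+ 2 * r ^+ n ^+ 2 / (n.+2%:R ^+ 2 * r ^+ 2).
have EI : E <= r ^- 4 * I.
  apply: (@le_trans _ _ (r ^- 2 * W)); last first.
    rewrite ler_pdivrMl ?exprn_gt0// mulrA (_ : r ^+ 2 * r ^- 4 = r ^- 2); last first.
      by field; rewrite gt_eqF.
    by rewrite ler_pdivlMl ?exprn_gt0.
  rewrite mulr_sumr; apply: ler_sum => n _.
  have A0 : 0 <= modulus (a n) ^+ 2 * r ^+ n ^+ 2 by rewrite mulr_ge0 ?sqr_ge0.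
  have -> A : r ^- 2 * (A / (n.+1%:R * n.+2%:R)) = A / (n.+1%:R * n.+2%:R * r ^+ 2).
    by rewrite [in RHS]invfM mulrC mulrA.
  rewrite ler_wpM2l// lef_pV2 ?posrE ?mulr_gt0 ?exprn_gt0//.
  by rewrite ler_wpM2r ?sqr_ge0// expr2 ler_wpM2r// ler_nat.
rewrite lerBlDr; apply: (@le_trans _ _ (energy mu r N.+1 + E)); last by rewrite lerD2l.
rewrite pairing// mulr_sumr /energy.
pose y n : R[i] := if n is m.+1 then (n.+1%:R * r ^+ n)^-1%:C * shifted n else 0.
have y0 : modulus (y 0%N) ^+ 2 = 0 by rewrite modulus0 expr0n.
have -> : E = \sum_(n < N.+1) modulus (y n) ^+ 2.
  rewrite big_ord_recl y0 add0r; apply: eq_bigr => n _.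
  rewrite lift0 /y modulusM exprMn modulus_shifted modulus_real real_normK ?num_real//.
  rewrite [r ^+ n.+1]exprS; field.
  by rewrite !gt_eqF ?exprn_gt0 ?ltr0n.
rewrite -big_split/=; apply: ler_sum => n _.
have -> : complex.Re (coef mu n * conjc (shifted n)) =
    complex.Re ((bcoef mu n * r%:C ^+ n) * conjc (y n)).
  case: n => -[|n] Nn; first by rewrite [nat_of_ord _]/= /y /shifted conjc0 !mulr0.
  rewrite [nat_of_ord _]/=; congr complex.Re.
  have -> : conjc (y n.+1) = (n.+2%:R * r ^+ n.+1)^-1%:C * conjc (shifted n.+1).
    apply: (etrans (rmorphM conjc _ _)); congr (_ * _); exact: conjc_real.
  have k0 : (n.+2%:R : R[i]) != 0 by rewrite pnatr_eq0.
  have rx : r%:C != 0 :> R[i] by apply/eqP => -[] /eqP; rewrite gt_eqF.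
  rewrite /bcoef; move: (conjc _) (coef _ _) => s c.
  rewrite fmorphV rmorphM rmorphXn rmorph_nat.
  move: k0 (expf_neq0 n.+1 rx); move: (n.+2%:R) (r%:C ^+ n.+1) => k x k0 x0.
  by field; rewrite k0 x0.
rewrite !sqr_modulus cReM cReJ cImJ; set x1 := complex.Re _; set x2 := complex.Im _.
set z1 := complex.Re _; set z2 := complex.Im _.
have h1 := sqr_ge0 (x1 - z1); have h2 := sqr_ge0 (x2 - z2).
by rewrite sqrrB in h1; rewrite sqrrB in h2; lra.
Qed.

(** The loss is the integral of [k |f|] over the disk of radius [r], where [k] is
    [1 - |z|] for [|z| < r^2] and [1] on the remaining annulus; the integral of
    [k^2 / (1 - |z|^2)] over that disk is at most 2. *)
Lemma shifted_mass_ge (d : R) : 0 < d ->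
  2 * J - d * I - 2 / d <= 2 * bint 1 (fun w => modulus (p (cplx w))).
Proof.
move=> d0; have r21 : r ^+ 2 < r by rewrite expr2 gtr_pMl.
have r2r : r ^+ 2 <= r := ltW r21.
have r4 : 0 < 1 - r ^+ 2 by rewrite subr_gt0 expr_lt1// ltW.
have hm : bm (fun w => modulus (cplx w)) by exact: bm_modulus (cbm_cplx _).
pose u w := modulus (cplx w) * modulus (f (cplx w)).
have hu : bm u by exact: bmM.
have mi s : bm (\1_(disk s) : plane R -> R) by exact: bm_indic (measurable_disk s).
have A1 : bint (r ^+ 2) u <= bint 1 (fun w => modulus (p (cplx w))).
  have t0 : 0 < r ^+ 2 <= 1 by rewrite exprn_gt0// expr_le1// ltW.
  have H := bint_dilate t0 (lexx 1) hu; rewrite (mulr1 (r ^+ 2)) in H.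
  rewrite H; last by move=> w _; rewrite mulr_ge0 ?modulus_ge0.
  have -> : bint 1 (fun w => u (dilate_plane (r ^+ 2) w)) =
      r ^+ 2 * bint 1 (fun w => modulus (p (cplx w))).
    rewrite -bintZ//; apply: eq_bint => w _; rewrite /u cplx_dilate psum_shifted !modulusM.
    by rewrite modulus_real ger0_norm ?sqr_ge0// mulrA.
  rewrite mulrA; apply: ler_piMl; first by apply: bint_ge0 => w _; exact: modulus_ge0.
  rewrite -exprSr; apply: exprn_ile1; first exact: sqr_ge0.
  by rewrite expr_le1// ltW.
pose k w := 1 - \1_(disk (r ^+ 2)) w * modulus (cplx w).
have hk : bm k by apply: bmB (bm_cst _) _; exact: bmM.
pose v w := 1 + (1 - \1_(disk (r ^+ 2)) w) * (1 - r ^+ 2)^-1.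
have hv : bm v.
  by apply: bmD (bm_cst _) _; apply: bmM; [apply: bmB (bm_cst _) _|exact: bm_cst].
have Jk : J - bint (r ^+ 2) u = bint r (fun w => k w * modulus (f (cplx w))).
  rewrite -(bint_indic _ r2r) -bintB//; last exact: bmM.
  by apply: eq_bint => w _; rewrite /k /u; ring.
have K1 : 2 * bint r (fun w => k w * modulus (f (cplx w))) <= d * I + d^-1 * bint r v.
  rewrite -!bintZ//; last exact: bmM.
  rewrite -bintD//; [|exact: bmZ|exact: bmZ].
  apply: le_bint => //; [apply: bmZ; exact: bmM|apply: bmD; exact: bmZ|].
  move=> w dw; have Dw := in_disk1 dw; have w1 := sub1_sqmod_gt0 Dw.
  have m0 := modulus_ge0 (cplx w); have m1 : modulus (cplx w) <= 1 by exact: ltW.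
  have k01 : 0 <= k w by rewrite /k indicE; case: (_ \in _); rewrite ?mul1r ?mul0r ?subr0 ?subr_ge0.
  have kv : k w ^+ 2 * (1 - sqmod w)^-1 <= v w.
    rewrite ler_pdivrMr// /k /v indicE; case: (boolP (w \in disk (r ^+ 2))) => [_|nw].
      rewrite mul1r subrr mul0r addr0 mul1r sqmod_cplx.
      by nra.
    rewrite mul0r subr0 mul1r expr1n.
    have : 1 <= (1 - r ^+ 2)^-1 * (1 - sqmod w).
      rewrite mulrC ler_pdivlMr// mul1r lerD2l lerN2 ltW//; exact: disk_sqmod.
    by lra.
  have h := amgm_weight (k w * modulus (f (cplx w))) d0 w1.
  (* completing the square with the weight [k] absorbed into the second term *)
  have : 2 * (k w * modulus (f (cplx w))) <=
      d * ((1 - sqmod w) * modulus (f (cplx w)) ^+ 2) + d^-1 * (k w ^+ 2 * (1 - sqmod w)^-1).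
    have ds : 0 < d * (1 - sqmod w) by rewrite mulr_gt0.
    set x := modulus _; set y := k w; set s := 1 - sqmod w in w1 ds *.
    rewrite -subr_ge0; have -> : d * (s * x ^+ 2) + d^-1 * (y ^+ 2 * s^-1) - 2 * (y * x) =
      (d * s * x - y) ^+ 2 / (d * s) by field; rewrite !gt_eqF.
    by rewrite divr_ge0 ?sqr_ge0// ltW.
  by move=> /le_trans; apply; rewrite lerD2l ler_wpM2l// invr_ge0 ltW.
have V1 : bint r v <= 2.
  rewrite bintD//; [|exact: bm_cst|]; last first.
    by apply: bmM; [apply: bmB (bm_cst _) _|exact: bm_cst].
  rewrite (bint_cst _ (ltW r0)) mul1r.
  have -> : bint r (fun w => (1 - \1_(disk (r ^+ 2)) w) * (1 - r ^+ 2)^-1) =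
     (1 - r ^+ 2)^-1 * (r ^+ 2 - r ^+ 2 ^+ 2).
    transitivity ((1 - r ^+ 2)^-1 * bint r (fun w => 1 - \1_(disk (r ^+ 2)) w * 1)).
      rewrite -bintZ//; last by apply: bmB (bm_cst _) _; apply: bmM; [|exact: bm_cst].
      by apply: eq_bint => w _; rewrite mulr1 mulrC.
    rewrite bintB//; [|exact: bm_cst|by apply: bmM; [|exact: bm_cst]].
    by rewrite bint_indic// !bint_cst ?sqr_ge0 ?(ltW r0)// !mul1r.
  have -> : (1 - r ^+ 2)^-1 * (r ^+ 2 - r ^+ 2 ^+ 2) = r ^+ 2 by field; rewrite gt_eqF.
  have : r ^+ 2 <= 1 by rewrite expr_le1// ltW.
  by lra.
have dV : d^-1 * bint r v <= d^-1 * 2 by rewrite ler_wpM2l// invr_ge0 ltW.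
rewrite -Jk in K1; rewrite [2 / d]mulrC; lra.
Qed.

(** Mass of the shifted polynomial on a smaller disk. *)
Lemma shifted_inner_mass_le (d s : R) : 0 < d -> 0 <= s < 1 ->
  2 * bint 1 (fun w => \1_(disk s) w * modulus (p (cplx w))) <=
  d * (r ^- 2 * I) + d^-1 * (1 - s ^+ 2)^-1.
Proof.
move=> d0 /andP[s0 s1]; have s21 : 0 < 1 - s ^+ 2 by rewrite subr_gt0 expr_lt1.
have mi : bm (\1_(disk s) : plane R -> R) by exact: bm_indic (measurable_disk s).
apply: (@le_trans _ _ (d * bint 1 (fun w => (1 - sqmod w) * modulus (p (cplx w)) ^+ 2)
  + bint 1 (fun=> d^-1 * (1 - s ^+ 2)^-1))); last first.
  rewrite bint_cst// expr1n mulr1 lerD2r ler_wpM2l ?(ltW d0)//.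
  exact: shifted_norm_le.
rewrite -!bintZ//; last exact: bmM.
rewrite -bintD//; [|exact: bmZ|exact: bm_cst].
apply: le_bint => //; [apply: bmZ; exact: bmM|apply: bmD (bm_cst _); exact: bmZ|].
move=> w Dw; have w1 := sub1_sqmod_gt0 Dw.
have d10 : 0 <= d^-1 by rewrite invr_ge0 ltW.
rewrite indicE; case: (boolP (w \in disk s)) => [|_].
  rewrite inE mul1r => ws; apply: (le_trans (amgm_weight _ d0 w1)).
  rewrite lerD2l ler_wpM2l// lef_pV2 ?posrE// lerD2l lerN2.
  by move: ws; rewrite diskE//= in_itv/= => /andP[_ /ltW].
rewrite mul0r mulr0; apply: addr_ge0; apply: mulr_ge0 => //; first exact: ltW.
  by apply: mulr_ge0; [exact: ltW|exact: sqr_ge0].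
by rewrite invr_ge0 ltW.
Qed.

(** Lower bound for the energy of any [mu] which is the unimodular part of the
    shifted polynomial on an annulus. *)
Lemma energy_lower (d s : R) : 0 < d -> 0 <= s < 1 ->
  exists2 B, 0 <= B & forall (t : R) (mu : plane R -> R[i]), 0 <= t <= 1 -> cbm mu ->
    (forall w, D w -> modulus (mu w) <= 1) ->
    (forall w, s <= modulus (cplx w) < t -> mu w = csign (p (cplx w))) ->
  2 * J - I - (r ^- 4 - 1 + d + 2 * d * r ^- 2) * I
    - (2 / d + 2 / (d * (1 - s ^+ 2)) + B * (1 - t ^+ 2)) <= energy mu r N.+1.
Proof.
move=> d0 s01; have [mp [M hM]] := hp.
exists (4 * `|M|); first by rewrite mulr_ge0.
move=> t mu /andP[t0 t1] hmu mu1 muE.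
have mi x : bm (\1_(disk x) : plane R -> R) by exact: bm_indic (measurable_disk x).
have hre : bm (fun w => complex.Re (mu w * conjc (p (cplx w)))).
  by case: (cbmM hmu (cbmJ (cbm_psum shifted N.+1))).
have hs : bm (fun w => \1_(disk s) w * modulus (p (cplx w))) by exact: bmM.
have ht : bm (fun w => (1 - \1_(disk t) w) * modulus (p (cplx w))).
  by apply: bmM => //; exact: bmB (bm_cst _) _.
have P1 : bint 1 (fun w => modulus (p (cplx w))) -
    2 * bint 1 (fun w => \1_(disk s) w * modulus (p (cplx w))) -
    2 * bint 1 (fun w => (1 - \1_(disk t) w) * modulus (p (cplx w))) <=
    bint 1 (fun w => complex.Re (mu w * conjc (p (cplx w)))).
  have h2s := bmZ 2 hs; have h2t := bmZ 2 ht.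
  rewrite -!bintZ// -bintB// -bintB//; last exact: bmB.
  apply: le_bint => //; first by apply: bmB => //; exact: bmB.
  move=> w Dw; have m0 := modulus_ge0 (p (cplx w)).
  have low : - modulus (p (cplx w)) <= complex.Re (mu w * conjc (p (cplx w))).
    rewrite lerNl -cReN (le_trans (Re_le_modulus _))// modulusN modulusM modulusJ.
    by rewrite ler_piMl// mu1.
  rewrite !indicE; case: (boolP (w \in disk s)) => [_|ns]; case: (boolP (w \in disk t)) => [wt|_];
    rewrite ?subrr ?subr0 ?mul0r ?mul1r ?mulr0; [lra|lra| |lra].
  move: wt ns; rewrite inE notin_setE => wt /negP; rewrite -leNgt => sw.
  by rewrite muE ?sw// csign_conj subr0 subr0.
have P2 : bint 1 (fun w => (1 - \1_(disk t) w) * modulus (p (cplx w))) <= `|M| * (1 - t ^+ 2).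
  apply: (@le_trans _ _ (bint 1 (fun w => `|M| * (1 - \1_(disk t) w * 1)))).
    apply: le_bint => //.
      by apply: bmZ; apply: bmB (bm_cst _) _; apply: bmM; [|exact: bm_cst].
    move=> w Dw; have i0 : 0 <= 1 - \1_(disk t) w :> R.
      by rewrite indicE; case: (_ \in _); rewrite ?subrr ?subr0.
    rewrite mulr1 [leRHS]mulrC; apply: ler_wpM2l => //.
    by apply: le_trans (ler_norm M); apply: le_trans (hM w Dw); exact: ler_norm.
  rewrite bintZ//; last by apply: bmB (bm_cst _) _; apply: bmM; [|exact: bm_cst].
  rewrite bintB//; [|exact: bm_cst|by apply: bmM; [|exact: bm_cst]].
  by rewrite bint_indic// !bint_cst// expr1n !mul1r.
have Q1 := shifted_mass_ge d0; have Q2 := shifted_inner_mass_le d0 s01.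
have Q3 := energy_ge_pairing hmu.
have -> : 2 / (d * (1 - s ^+ 2)) = 2 * (d^-1 * (1 - s ^+ 2)^-1) by rewrite invfM.
have -> : (r ^- 4 - 1 + d + 2 * d * r ^- 2) * I =
  r ^- 4 * I - I + d * I + 2 * (d * (r ^- 2 * I)) by ring.
lra.
Qed.

End LowerBound.

(** * Upper and lower limits at one; the upper inequality *)

Section Limits.
Variable R : realType.
Implicit Types (F : R -> \bar R).

Lemma at_leftP (V : set R) :
  ((1 : R)^'-) V -> exists2 s, s < 1 & forall r, s < r < 1 -> V r.
Proof.
rewrite /at_left /within/= => /nbhs_ballP[e /= e0 h].
exists (1 - e); first by rewrite ltrBlDr ltrDl.
move=> r /andP[sr r1]; apply: h => //; rewrite /ball/= ger0_norm ?subr_ge0 ?ltW//.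
by rewrite ltrBlDr -ltrBlDl.
Qed.

Lemma at_leftI (s : R) : s < 1 -> ((1 : R)^'-) [set r | s < r < 1].
Proof.
move=> s1; have : \forall r \near (1 : R)^'-, s < r by exact: nbhs_left_gt.
by apply: filterS2 (nbhs_left_lt 1) => r r1 sr /=; rewrite sr.
Qed.

Lemma limf_esup_le F (y : \bar R) (s : R) : s < 1 ->
  (forall r, s < r < 1 -> (F r <= y)%E) -> (limf_esup F (1 : R)^'- <= y)%E.
Proof.
move=> s1 h; apply: (@le_trans _ _ (ereal_sup (F @` [set r | s < r < 1]))).
  by apply: ereal_inf_lbound; exists [set r | s < r < 1] => //; exact: at_leftI.
by apply: ge_ereal_sup => _ [r sr <-]; exact: h.
Qed.

Lemma limf_esup_ge F (y : \bar R) :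
  (forall s, s < 1 -> exists2 r, s < r < 1 & (y <= F r)%E) ->
  (y <= limf_esup F (1 : R)^'-)%E.
Proof.
move=> h; apply: le_ereal_inf_tmp => _ [V /at_leftP[s s1 sV] <-].
have [r sr yr] := h s s1; apply: (le_trans yr); apply: ereal_sup_ubound.
by exists r => //; exact: sV.
Qed.

Lemma limf_einf_gt F (y : \bar R) : (y < limf_einf F (1 : R)^'-)%E ->
  exists2 s, s < 1 & forall r, s < r < 1 -> (y <= F r)%E.
Proof.
rewrite limf_einfE => /ereal_sup_gt[_ [V /at_leftP[s s1 sV] <-] yV].
exists s => // r /sV Vr; apply: (le_trans (ltW yV)); apply: ereal_inf_lbound.
by exists r.
Qed.

Lemma limf_einf_lt F (y : \bar R) : (limf_einf F (1 : R)^'- < y)%E ->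
  forall s, s < 1 -> exists2 r, s < r < 1 & (F r < y)%E.
Proof.
rewrite limf_einfE => h s s1.
have : (ereal_inf (F @` [set r : R | (s < r < 1)%R]) < y)%E.
  apply: le_lt_trans h; apply: ereal_sup_ubound.
  by exists [set r | s < r < 1] => //; exact: at_leftI.
by move=> /ereal_inf_lt[_ [r sr <-] yr]; exists r.
Qed.

Lemma limf_einf_le F (y : \bar R) :
  (forall s, s < 1 -> exists2 r, s < r < 1 & (F r <= y)%E) ->
  (limf_einf F (1 : R)^'- <= y)%E.
Proof.
move=> h; rewrite limf_einfE; apply: ge_ereal_sup => _ [V /at_leftP[s s1 sV] <-].
have [r sr yr] := h s s1; apply: le_trans yr; apply: ereal_inf_lbound.
by exists r => //; exact: sV.
Qed.

End Limits.

Section Density.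
Variable R : realType.
Local Notation rho := (zero_packing_density R).

Lemma discrepancy_ge0 (r : R) (f : {poly R[i]}) : 0 < r < 1 -> (0 <= discrepancy r f)%E.
Proof.
move=> r01; apply: mule_ge0.
  by rewrite lee_fin invr_ge0 ltW// log_weight_gt0.
apply: integral_ge0 => w dw; rewrite lee_fin divr_ge0 ?sqr_ge0//.
rewrite -sqmod_cplx ltW// sub1_sqmod_gt0//.
by apply: subset_disk dw; rewrite ltW//; case/andP: r01.
Qed.

Lemma discrepancy0 (r : R) : 0 < r < 1 -> discrepancy r 0 = 1%E.
Proof.
move=> r01; rewrite (discrepancyE r01 (a := fun=> 0) (N := 0)); last first.
  by move=> z; rewrite horner0 /psum big_ord0.
congr EFin; have L0 := log_weight_gt0 r01.
have -> : bint r (fun w => modulus (psum (fun=> 0) 0 (cplx w))) = 0 :> R.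
  by rewrite -[RHS](bint0 r); apply: eq_bint => w _; rewrite /psum big_ord0 modulus0.
have -> : bint r (fun w => (1 - sqmod w) * modulus (psum (fun=> 0) 0 (cplx w)) ^+ 2) = 0 :> R.
  by rewrite -[RHS](bint0 r); apply: eq_bint => w _; rewrite /psum big_ord0 modulus0 expr0n mulr0.
by rewrite mulr0 subr0 addr0 divff// gt_eqF.
Qed.

Lemma zero_packing_density_fin : exists2 x : R, rho = x%:E & 0 <= x <= 1.
Proof.
have h0 : (0%:E <= rho)%E.
  rewrite leNgt; apply/negP => /limf_einf_lt/(_ _ (@ltr01 R))[r r01].
  by rewrite ltNge => /negP; apply; apply: le_ereal_inf_tmp => _ [f _ <-]; exact: discrepancy_ge0.
have h1 : (rho <= 1%:E)%E.
  apply: limf_einf_le => s s1; pose m := Num.max s 0.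
  have m1 : m < 1 by rewrite gt_max s1 ltr01.
  have [h2 h3] := midf_lt m1.
  have r01 : 0 < (m + 1) / 2 < 1 by rewrite h3 andbT (le_lt_trans _ h2)// le_max lexx orbT.
  exists ((m + 1) / 2); first by rewrite h3 andbT (le_lt_trans _ h2)// le_max lexx.
  by apply: ereal_inf_lbound; exists 0 => //; exact: discrepancy0.
have f : rho \is a fin_num.
  by rewrite ge0_fin_numE// (le_lt_trans h1)// ltry.
by exists (fine rho); rewrite ?fineK// -!lee_fin fineK// h0 h1.
Qed.

Section Competitor.
Variable mu : plane R -> R[i].
Hypotheses (hmu : cbm mu) (mu1 : forall w, disk (1 : R) w -> modulus (mu w) <= 1).

(** The upper inequality for a function bounded by one on the disk. *)
Lemma asymptotic_variance_le : (asymptotic_variance (bergman_projection mu) <= 1 - rho)%E.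
Proof.
have [x xE /andP[x0 x1]] := zero_packing_density_fin; rewrite xE -EFinB.
apply/lee_addgt0Pr => e e0; pose b := 1 - x + e / 2.
have b0 : 0 < b by rewrite /b; lra.
have /limf_einf_gt[s s1 hs] : ((x - e / 2)%:E < rho)%E by rewrite xE lte_fin; lra.
(* it suffices that [2 * r ^+ 2 - 1] is at least [k], and this follows from
   [(3 + k) / 4 <= r] by convexity *)
pose k := b / (b + e / 2).
have be : 0 < b + e / 2 by lra.
have k1 : k < 1 by rewrite ltr_pdivrMr// mul1r; lra.
have k0 : 0 < k by rewrite divr_gt0.
apply: (limf_esup_le (s := Num.max s ((3 + k) / 4))).
  by rewrite gt_max s1 /=; lra.
move=> r; rewrite gt_max => /andP[/andP[sr kr] r1].
have r0 : 0 < r by lra.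
have r01 : 0 < r < 1 by rewrite r0.
have L0 := log_weight_gt0 r01; set L := log_weight r in L0 *.
have rk : k <= 2 * r ^+ 2 - 1.
  have := sqr_ge0 (r - 1); rewrite sqrrB1 => h; lra.
have [c [-> _ cle]] := circle_mean_energy hmu mu1 r01.
rewrite inver gt_eqF// -EFinM -EFinD lee_fin ler_pdivrMr//.
apply: cle => N.
have [f] := energy_discrepancy N hmu mu1 r01; rewrite -/L => hf.
have : ((x - e / 2)%:E <= (1 - (2 * r ^+ 2 - 1) * energy mu r N / L)%:E)%E.
  apply: le_trans hf; apply: (le_trans (hs r _)); first by rewrite sr.
  by apply: ereal_inf_lbound; exists f.
rewrite lee_fin => h.
have X0 : 0 <= energy mu r N by apply: sumr_ge0 => n _; exact: sqr_ge0.
have h1 : (2 * r ^+ 2 - 1) * energy mu r N / L <= b by rewrite /b; lra.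
have h2 : k * energy mu r N <= b * L.
  rewrite ler_pdivrMr// in h1; apply: le_trans h1.
  by rewrite ler_wpM2r.
have -> : 1 - x + e = b + e / 2 by rewrite /b; lra.
have : b * energy mu r N <= b * ((b + e / 2) * L).
  have -> : b * energy mu r N = (b + e / 2) * (k * energy mu r N).
    by rewrite mulrA /k [b / _]mulrC mulrA divff ?mul1r// gt_eqF.
  by rewrite [leRHS]mulrCA ler_wpM2l// ltW.
by rewrite ler_pM2l.
Qed.

End Competitor.

End Density.

(** * Normalization, gluing, and the lower inequality *)

Section Normalization.
Variable R : realType.
Implicit Types (w : plane R) (z : R[i]) (mu : plane R -> R[i]).
Local Notation D := (disk (1 : R)).

Lemma dA_disk_setT : dA_disk R [set: plane R] = 1%E.
Proof.
have -> : dA_disk R [set: plane R] = dA R ([set: plane R] `&` D) by [].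
by rewrite setTI dA_diskE// expr1n.
Qed.

Lemma Linfty_normE mu :
  Linfty_norm mu = ess_sup (dA_disk R) (fun w => `|(modulus (mu w))%:E|%E).
Proof. by rewrite /Linfty_norm unlock dA_disk_setT lte01. Qed.

Lemma Linfty_norm_unimodular mu : (forall w, modulus (mu w) = 1) -> Linfty_norm mu = 1%E.
Proof.
move=> mu1; rewrite Linfty_normE.
rewrite (_ : (fun _ => _) = cst 1%E); last by apply/funext => w; rewrite mu1/= normr1.
by rewrite ess_sup_cst// dA_disk_setT lte01.
Qed.

(** A competitor may be changed on a null set so that it is bounded by one at
    every point of the disk; its Bergman projection is not affected. *)
Lemma competitor_bounded mu : measurable_on_disk mu -> Linfty_norm mu = 1%E ->
  exists nu, [/\ cbm nu, forall w, D w -> modulus (nu w) <= 1 &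
    forall z, modulus z < 1 -> bergman_projection mu z = bergman_projection nu z].
Proof.
move=> [mm1 mm2] mu1; pose nu w : R[i] := if modulus (mu w) <= 1 then mu w else 0.
have mmod : measurable_fun D (fun w => modulus (mu w)).
  under eq_fun do rewrite modulusE.
  apply: (measurableT_comp (f := @Num.sqrt R)).
    exact: continuous_measurable_fun (@sqrt_continuous R).
  by apply: measurable_funD; exact: measurable_funX.
have mD : measurable D by exact: measurable_disk.
have nu1 w : D w -> modulus (nu w) <= 1.
  by move=> _; rewrite /nu; case: ifPn => // _; rewrite modulus0.
pose E := D `&` [set w | modulus (mu w) <= 1].
have mE : measurable E.
  have -> : E = D `&` (fun w => modulus (mu w)) @^-1` `]-oo, 1]%classic.
    by apply/seteqP; split => w [Dw] /=; rewrite /E/= ?in_itv/=.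
  exact: mmod.
have nuE w : D w -> nu w = (\1_E w)%:C * mu w.
  move=> Dw; rewrite /nu indicE; case: ifPn => [h|/negP h].
    by rewrite mem_set// mul1r.
  by rewrite memNset ?mul0r// => -[].
have mi : measurable_fun D (\1_E : plane R -> R) by exact: measurable_indic.
have hnu : cbm nu.
  apply: cbm_bounded; last by exists 1.
  split.
    apply: (eq_measurable_fun (fun w => \1_E w * complex.Re (mu w))).
      by move=> w /[!inE] Dw; rewrite nuE// cReZ.
    exact: measurable_funM.
  apply: (eq_measurable_fun (fun w => \1_E w * complex.Im (mu w))).
    by move=> w /[!inE] Dw; rewrite nuE// cImZ.
  exact: measurable_funM.
exists nu; split => // z z1.
have [A [mA A0 sA]] : (dA R).-negligible (D `&` [set w | nu w <> mu w]).
  have : \forall w \ae dA_disk R, (`|(modulus (mu w))%:E| <= 1)%E.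
    by apply/ess_supP; rewrite -Linfty_normE mu1.
  case=> A [mA A0 sA]; exists (A `&` D); split => //; first exact: measurableI.
  move=> w [Dw nw]; split => //; apply: sA => /=; rewrite lee_fin => h; apply: nw.
  by rewrite /nu -(ger0_norm (modulus_ge0 (mu w))) h.
have s10 : 0 < 1 - modulus z by rewrite subr_gt0.
have hK : cbm (fun w => (1 - z * conjc (cplx w))^-1 ^+ 2).
  apply: cbmX; apply: (cbmV s10).
    by apply: cbmD (cbm_cst _) _; apply: cbmN; apply: cbmM (cbm_cst _) _; exact: cbmJ (cbm_cplx _).
  by move=> w Dw; exact: modulus_1B.
have [[mK1 _] [mK2 _]] := hK; have [[mn1 _] [mn2 _]] := hnu.
rewrite /bergman_projection /complex_integral /Rintegral; congr (fine _ +i* fine _).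
- apply: ae_eq_integral => //.
  + apply/measurable_EFinP; under eq_fun do rewrite -exprVn cReM.
    by apply: measurable_funB; exact: measurable_funM.
  + apply/measurable_EFinP; under eq_fun do rewrite -exprVn cReM.
    by apply: measurable_funB; exact: measurable_funM.
  + exists A; split => // w /= h; apply: sA; split; first by apply: contrapT => n; apply: h.
    by move=> e; apply: h => _; rewrite e.
- apply: ae_eq_integral => //.
  + apply/measurable_EFinP; under eq_fun do rewrite -exprVn cImM.
    by apply: measurable_funD; exact: measurable_funM.
  + apply/measurable_EFinP; under eq_fun do rewrite -exprVn cImM.
    by apply: measurable_funD; exact: measurable_funM.
  + exists A; split => // w /= h; apply: sA; split; first by apply: contrapT => n; apply: h.
    by move=> e; apply: h => _; rewrite e.
Qed.

Lemma eq_asymptotic_variance (g h : R[i] -> R[i]) :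
  (forall z, modulus z < 1 -> g z = h z) -> asymptotic_variance g = asymptotic_variance h.
Proof.
have le (g1 g2 : R[i] -> R[i]) : (forall z, modulus z < 1 -> g1 z = g2 z) ->
    (asymptotic_variance g1 <= asymptotic_variance g2)%E.
  move=> e; rewrite /asymptotic_variance; set F1 := fun r => _; set F2 := fun r => _.
  have F12 r : 0 < r < 1 -> F1 r = F2 r.
    move=> /andP[r0 r1]; rewrite /F1 /F2; congr (_ / _)%E; rewrite /circle_integral.
    congr (_ * _)%E; apply: eq_integral => t _; congr ((modulus _ ^+ 2)%:E).
    by rewrite /dilate e// modulusM modulus_cis mulr1 modulus_real gtr0_norm.
  apply: le_ereal_inf_tmp => _ [V /at_leftP[s s1 sV] <-].
  have m1 : Num.max s 0 < 1 by rewrite gt_max s1 ltr01.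
  apply: (limf_esup_le m1) => r; rewrite gt_max => /andP[/andP[sr r0] r1].
  rewrite F12 ?r0//; apply: ereal_sup_ubound; exists r => //.
  by apply: sV; rewrite sr.
by move=> gh; apply/le_anti; rewrite !le// => z /gh.
Qed.

End Normalization.

Section Gluing.
Variable R : realType.
Implicit Types (w : plane R) (z : R[i]) (mu nu : plane R -> R[i]).
Local Notation D := (disk (1 : R)).
Local Notation rho := (zero_packing_density R).

Lemma log_weight_ge (K r : R) : 0 < r < 1 -> 1 - expR (- K) / 2 <= r -> K <= log_weight r.
Proof.
move=> /andP[r0 r1] h; have r21 : 0 < 1 - r ^+ 2 by rewrite subr_gt0 expr_lt1// ltW.
rewrite /log_weight div1r lnV ?posrE// lerNr -ler_expR lnK ?posrE//.
have : 0 <= (1 - r) ^+ 2 by exact: sqr_ge0.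
rewrite sqrrB expr1n mul1r => h3; lra.
Qed.

Lemma expr4_ge_tangent (r : R) : 4 * r - 3 <= r ^+ 4.
Proof.
have : 0 <= (r - 1) ^+ 2 * ((r + 1) ^+ 2 + 2) by rewrite mulr_ge0 ?sqr_ge0// addr_ge0 ?sqr_ge0.
have -> : (r - 1) ^+ 2 * ((r + 1) ^+ 2 + 2) = r ^+ 4 - 4 * r + 3 by ring.
lra.
Qed.

(** Given [s], there are [r] and [t] arbitrarily close to one such that
    prescribing a suitable unimodular function on [s <= |w| < t] forces a large
    energy at [r], whatever the values, bounded by one, on the rest of the disk. *)
Lemma extremal_annulus (c d s r' : R) : (rho < (1 - c)%:E)%E -> 0 < c -> 0 < d ->
  0 <= s < 1 -> r' < 1 ->
  exists r t nu, [/\ r' < r < 1, 0 < r, s < t < 1 /\ r' < t,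
    measT nu /\ (forall w, modulus (nu w) = 1) &
    forall mu, cbm mu -> (forall w, D w -> modulus (mu w) <= 1) ->
      (forall w, s <= modulus (cplx w) < t -> mu w = nu w) ->
      exists N, (c - 25 * d) * log_weight r <= energy mu r N].
Proof.
move=> hc c0 d0 s01 r'1; have /andP[s0 s1] := s01.
(* lower bounds for [r]: [m1] makes [d * log_weight r] absorb the terms which
   depend only on [d] and [s], [m2] makes [r ^- 4] at most [1 + d] *)
pose K := (2 / d + 2 / (d * (1 - s ^+ 2)) + 1) / d.
pose m1 := 1 - expR (- K) / 2; pose m2 := 1 - d / (4 * (1 + d)).
have m11 : m1 < 1 by rewrite ltrBlDr ltrDl divr_gt0// expR_gt0.
have m21 : m2 < 1 by rewrite ltrBlDr ltrDl divr_gt0// mulr_gt0// addr_gt0.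
have ms : Num.max (Num.max r' (3 / 4)) (Num.max m1 m2) < 1.
  by rewrite !gt_max r'1 m11 m21 /=; lra.
have [r /andP[+ r1] hr] := limf_einf_lt hc ms.
rewrite !gt_max => /andP[/andP[r'r r34] /andP[m1r m2r]].
have r0 : 0 < r by lra.
have r01 : 0 < r < 1 by rewrite r0.
have L0 := log_weight_gt0 r01.
have KL : K <= log_weight r by apply: log_weight_ge => //; exact: ltW.
have [_ [f _ <-]] := ereal_inf_lt hr.
rewrite (discrepancyE r01 (a := fun n => f`_n) (N := size f)); last first.
  by move=> z; rewrite horner_coef.
set a := fun n => f`_n; set N := size f.
set J := bint r (fun w => modulus _); set I := bint r (fun w => _ * modulus _ ^+ 2).
set L := log_weight r in L0 KL *.
rewrite lte_fin ltr_pdivrMr// => hJ.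
have JI : c * L < 2 * J - I by lra.
have JI0 : 0 < 2 * J - I by apply: lt_trans JI; exact: mulr_gt0.
have I4 : I <= 4 * L := energy_bound_log r01 JI0.
have I0 : 0 <= I.
  apply: bint_ge0 => w dw; rewrite mulr_ge0 ?sqr_ge0// ltW// sub1_sqmod_gt0//.
  exact: subset_disk (ltW r1) _ dw.
have [B B0 hB] := energy_lower a N r01 d0 s01.
(* [m3] makes the contribution of the values beyond the radius [t] at most one *)
pose m3 := 1 - (2 * (B + 1))^-1.
have m31 : m3 < 1 by rewrite ltrBlDr ltrDl invr_gt0 mulr_gt0// ltr_wpDl.
have mt : Num.max (Num.max s r') m3 < 1 by rewrite !gt_max s1 r'1 m31.
have [+ t1] := midf_lt mt; set t := (_ + 1) / 2 in t1 *.
rewrite !gt_max => /andP[/andP[st r't] m3t].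
exists r, t, (fun w => csign (psum (shifted r a) N.+1 (cplx w))); split.
- by rewrite r'r.
- by [].
- by rewrite st.
- split; last by move=> w; exact: modulus_csign.
  exact: measT_csign (measT_psum _ _).
move=> mu hmu mu1 muE; exists N.+1.
have t01 : 0 <= t <= 1 by rewrite (ltW (le_lt_trans s0 st)) ltW.
apply: le_trans (hB t mu t01 hmu mu1 muE); rewrite -/J -/I.
have Bt : B * (1 - t ^+ 2) <= 1.
  have b1 : 0 < 2 * (B + 1) by rewrite mulr_gt0// ltr_wpDl.
  have t2 : 1 - t ^+ 2 <= 2 * (1 - t).
    have : 0 <= (1 - t) ^+ 2 by exact: sqr_ge0.
    by rewrite sqrrB expr1n mul1r => h; lra.
  have t3 : 2 * (1 - t) * (B + 1) <= 1.
    have : 1 - t <= (2 * (B + 1))^-1 by rewrite /m3 in m3t; lra.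
    by rewrite -[(_)^-1]mul1r ler_pdivlMr// => h; lra.
  have t0 : 0 <= 1 - t by lra.
  have : B * (1 - t ^+ 2) <= B * (2 * (1 - t)) by rewrite ler_wpM2l.
  lra.
have dL : 2 / d + 2 / (d * (1 - s ^+ 2)) + 1 <= d * L.
  by rewrite [leRHS]mulrC -ler_pdivrMr//; exact: KL.
have r4 : r ^- 4 <= 1 + d.
  have d1 : 0 < 1 + d by lra.
  rewrite -[1 + d]invrK lef_pV2 ?posrE ?invr_gt0 ?exprn_gt0//.
  apply: le_trans (expr4_ge_tangent r).
  have : m2 <= r by exact: ltW.
  rewrite /m2 => h; have e : (1 + d)^-1 = 1 - 4 * (d / (4 * (1 + d))).
    by field; rewrite gt_eqF.
  by rewrite e; lra.
have r2 : r ^- 2 <= 2.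
  rewrite -[2 in leRHS]invrK lef_pV2 ?posrE ?invr_gt0 ?exprn_gt0//.
  have : 0 <= (r - 3 / 4) ^+ 2 by exact: sqr_ge0.
  by rewrite sqrrB => h; lra.
(* the coefficient 25 of [d] is [6 * 4 + 1] *)
have cI : (r ^- 4 - 1 + d + 2 * d * r ^- 2) * I <= (6 * d) * (4 * L).
  apply: (@le_trans _ _ ((6 * d) * I)); last by rewrite ler_wpM2l// mulr_ge0// ltW.
  rewrite ler_wpM2r//.
  have : d * r ^- 2 <= d * 2 by rewrite ler_wpM2l// ltW.
  lra.
by rewrite -/L; lra.
Qed.

(** Gluing extremal annuli whose radii tend to one. *)
Lemma glued_competitor (c d : R) : (rho < (1 - c)%:E)%E -> 0 < c -> 0 < d ->
  exists mu, [/\ measurable_on_disk mu, forall w, modulus (mu w) = 1 &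
    forall s, s < 1 -> exists r N, [/\ s < r < 1, 0 < r &
      (c - 25 * d) * log_weight r <= energy mu r N]].
Proof.
move=> hc c0 d0.
pose P (sj : R * nat) (y : R * R * (plane R -> R[i])) :=
  0 <= sj.1 < 1 ->
  let: (r, t, nu) := y in let r' := 1 - sj.2.+1%:R^-1 in
  [/\ r' < r < 1, 0 < r, sj.1 < t < 1 /\ r' < t,
    measT nu /\ (forall w, modulus (nu w) = 1) &
    forall mu, cbm mu -> (forall w, D w -> modulus (mu w) <= 1) ->
      (forall w, sj.1 <= modulus (cplx w) < t -> mu w = nu w) ->
      exists N, (c - 25 * d) * log_weight r <= energy mu r N].
have j1 j : 1 - j.+1%:R^-1 < 1 :> R by rewrite ltrBlDr ltrDl invr_gt0.
have /choice[F hF] : forall sj, exists y, P sj y.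
  move=> [s j]; have [s01|ns] := boolP (0 <= s < 1).
    have [r [t [nu h]]] := extremal_annulus hc c0 d0 s01 (j1 j).
    by exists (r, t, nu).
  by exists (0, 0, fun=> 0) => /= s01; rewrite s01 in ns.
(* the [j]-th annulus is [S j <= |w| < S j.+1], prescribed to be [nu j] there *)
pose S := fix S j : R := if j is k.+1 then (F (S k, k)).1.2 else 0.
pose rr j := (F (S j, j)).1.1; pose nu j := (F (S j, j)).2.
have Pj j : 0 <= S j < 1 -> [/\ 1 - j.+1%:R^-1 < rr j < 1, 0 < rr j,
    S j < S j.+1 < 1 /\ 1 - j.+1%:R^-1 < S j.+1,
    measT (nu j) /\ (forall w, modulus (nu j w) = 1) &
    forall mu, cbm mu -> (forall w, D w -> modulus (mu w) <= 1) ->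
      (forall w, S j <= modulus (cplx w) < S j.+1 -> mu w = nu j w) ->
      exists N, (c - 25 * d) * log_weight (rr j) <= energy mu (rr j) N].
  by move=> Sj; have := hF (S j, j) Sj; rewrite /rr /nu [S j.+1]/=; case: (F _) => -[].
have S01 j : 0 <= S j < 1.
  elim: j => [|j IH]; first by rewrite /= lexx ltr01.
  have [_ _ [/andP[h1 h2] _] _ _] := Pj j IH.
  by rewrite h2 andbT (le_trans _ (ltW h1))//; case/andP: IH.
have Sinc j k : (j <= k)%N -> S j <= S k.
  elim: k => [|k IH]; first by rewrite leqn0 => /eqP ->.
  rewrite leq_eqVlt => /predU1P[->//|]; rewrite ltnS => /IH h.
  by have [_ _ [/andP[h1 h2] _] _ _] := Pj k (S01 k); rewrite (le_trans h)// ltW.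
pose A j : set (plane R) := disk (S j.+1) `\` disk (S j).
have AE j w : A j w <-> S j <= modulus (cplx w) < S j.+1.
  split; first by move=> [h1 /negP]; rewrite -leNgt => h2; rewrite h2.
  by move=> /andP[h1 h2]; split => //; apply/negP; rewrite -leNgt.
have Auniq j k w : A j w -> A k w -> j = k.
  move=> /AE/andP[j1' j2] /AE/andP[k1 k2]; apply/eqP; rewrite eqn_leq; apply/andP; split.
    rewrite leqNgt; apply/negP => kj.
    by have := le_lt_trans (le_trans (Sinc _ _ kj) j1') k2; rewrite ltxx.
  rewrite leqNgt; apply/negP => jk.
  by have := le_lt_trans (le_trans (Sinc _ _ jk) k1) j2; rewrite ltxx.
have DA : D = \bigcup_j A j.
  apply/seteqP; split => w; last first.
    by move=> [j _ [h _]]; apply: subset_disk h; have /andP[_ /ltW] := S01 j.+1.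
  move=> Dw; have w1 : 0 < 1 - modulus (cplx w) by rewrite subr_gt0.
  have [n hn] : exists n, modulus (cplx w) < S n.
    pose n := Num.truncn (1 - modulus (cplx w))^-1; exists n.+1.
    have [_ _ [_ h] _ _] := Pj n (S01 n); apply: lt_trans h.
    rewrite ltrBrDl -ltrBrDr.
    rewrite -[ltRHS]invrK ltf_pV2 ?posrE ?invr_gt0//; exact: truncnS_gt.
  have [j hj jmin] := ex_minnP (ex_intro (fun n => modulus (cplx w) < S n) n hn).
  case: j hj jmin => [|j] hj jmin.
    by have := modulus_ge0 (cplx w); rewrite leNgt hj.
  exists j => //; apply/AE; rewrite hj andbT leNgt; apply/negP => /jmin.
  by rewrite ltnn.
pose ix w := xget 0%N [set j | A j w].
have ixE j w : A j w -> ix w = j.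
  move=> Aj; apply: (Auniq _ _ w _ Aj); rewrite /ix.
  by case: xgetP => [k _ //|/(_ j)].
pose mu w := nu (ix w) w.
have mu1 w : modulus (mu w) = 1.
  by have [_ _ _ [_ h] _] := Pj (ix w) (S01 _); exact: h.
have mA j : measurable (A j) by apply: measurableD; exact: measurable_disk.
have mmu : measurable_on_disk mu.
  split; rewrite DA; apply/(measurable_fun_bigcup _ mA) => j;
  have [_ _ _ [[m1 m2] _] _] := Pj j (S01 j).
    apply: (eq_measurable_fun (fun w => complex.Re (nu j w))).
      by move=> w /[!inE] /ixE e; rewrite /mu e.
    exact: measurable_funTS.
  apply: (eq_measurable_fun (fun w => complex.Im (nu j w))).
    by move=> w /[!inE] /ixE e; rewrite /mu e.
  exact: measurable_funTS.
have hmu : cbm mu by apply: cbm_bounded => //; exists 1 => w _; rewrite mu1.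
exists mu; split => // s s1.
pose j := Num.truncn (1 - s)^-1.
have [/andP[r1 r2] r0 _ _ hE] := Pj j (S01 j).
have [|w h|N hN] := hE mu hmu.
- by move=> w _; rewrite mu1.
- by rewrite /mu (ixE j)//; apply/AE.
exists (rr j), N; split => //; rewrite r2 andbT; apply: lt_trans r1.
rewrite ltrBrDl -ltrBrDr -[ltRHS]invrK ltf_pV2 ?posrE ?invr_gt0 ?subr_gt0//.
exact: truncnS_gt.
Qed.

Lemma universal_variance_ge0 : (0 <= universal_asymptotic_variance R)%E.
Proof.
apply: le_ereal_sup_tmp; exists (asymptotic_variance (bergman_projection (fun=> 1))).
  exists (fun=> 1) => //; split; first by split.
  by apply: Linfty_norm_unimodular => w; exact: modulus1.
apply: limf_esup_ge => s s1; have m1 : Num.max s 0 < 1 by rewrite gt_max s1 ltr01.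
have [+ h3] := midf_lt m1; rewrite gt_max => /andP[h2 h0].
exists ((Num.max s 0 + 1) / 2); first by rewrite h2.
have L0 := log_weight_gt0 (introT andP (conj h0 h3)).
rewrite inver gt_eqF// mule_ge0//; last by rewrite lee_fin invr_ge0 ltW.
apply: mule_ge0; first by rewrite lee_fin invr_ge0 mulr_ge0 ?pi_ge0.
by apply: integral_ge0 => t _; rewrite lee_fin sqr_ge0.
Qed.

Lemma universal_variance_ge : (1 - rho <= universal_asymptotic_variance R)%E.
Proof.
have [x xE /andP[x0 x1]] := zero_packing_density_fin R.
rewrite xE -EFinB; apply/lee_subgt0Pr => e e0; rewrite -EFinB.
have [c0|c0] := leP (1 - x - e) 0.
  by apply: le_trans universal_variance_ge0; rewrite lee_fin.
pose d := e / 50; pose c := 1 - x - e / 2.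
have d0 : 0 < d by rewrite divr_gt0.
have hc : (rho < (1 - c)%:E)%E by rewrite xE lte_fin /c; lra.
have c1 : 0 < c by rewrite /c; lra.
have [mu [mmu mu1 hmu]] := glued_competitor hc c1 d0.
have cmu : cbm mu by apply: cbm_bounded => //; exists 1 => w _; rewrite mu1.
have mu1' w : D w -> modulus (mu w) <= 1 by rewrite mu1.
apply: le_ereal_sup_tmp; exists (asymptotic_variance (bergman_projection mu)).
  by exists mu => //; split => //; exact: Linfty_norm_unimodular.
apply: limf_esup_ge => s /hmu[r [N [/andP[sr r1] r0 hN]]].
exists r; first by rewrite sr.
have r01 : 0 < r < 1 by rewrite r0.
have L0 := log_weight_gt0 r01.
have [y [-> Xy _]] := circle_mean_energy cmu mu1' r01.
rewrite inver gt_eqF// -EFinM lee_fin ler_pdivlMr//.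
apply: (le_trans _ (Xy N)); apply: le_trans hN.
by rewrite ler_wpM2r ?(ltW L0)// /c /d; lra.
Qed.

Lemma universal_variance_le : (universal_asymptotic_variance R <= 1 - rho)%E.
Proof.
apply: ge_ereal_sup => _ [mu [mmu mu1] <-].
have [nu [hnu nu1 e]] := competitor_bounded mmu mu1.
by rewrite (eq_asymptotic_variance e); exact: asymptotic_variance_le.
Qed.

End Gluing.

Theorem theorem1p5p5 (R : realType) :
  universal_asymptotic_variance R = (1 - zero_packing_density R)%E.
Proof.
apply/le_anti; apply/andP; split.
  exact: universal_variance_le.
exact: universal_variance_ge.
Qed.
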